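(* Let $\gamma$ be a real number. If $B_n\in\Omega_n$ is any polyomino chain with $n\geq 3$ squares, then $$R_\gamma(L_n)\leq R_\gamma(B_n)\leq R_\gamma(Z_n)\quad\text{for } \gamma>0,$$ $$ABC_\gamma(L_n)\leq ABC_\gamma(B_n)\leq ABC_\gamma(Z_n)\quad\text{for } \gamma>1,$$ $$\chi_\gamma(L_n)\leq \chi_\gamma(B_n)\leq \chi_\gamma(Z_n)\quad\text{for } \gamma>0,$$ with left (respectively right) equalities if and only if $B_n\cong L_n$ (respectively $B_n\cong Z_n$).
   Context: A polyomino system is a finite 2-connected plane graph in which each interior face is a regular (unit) square of side length one. Two squares are adjacent if they share an edge. A polyomino chain is a polyomino system in which every square is adjacent to at most two squares; its squares form a sequence $C_1,\dots,C_n$ in which exactly consecutive squares are adjacent. A square adjacent to only one other square is terminal; a square adjacent to two other squares is non-terminal. A kink is a non-terminal square having a vertex of degree 2 (degrees are taken in the graph of the chain). The linear chain $L_n$ is the polyomino chain with $n$ squares without kinks. The zigzag chain $Z_n$ is the polyomino chain with $n$ squares consisting only of kinks and terminal squares. A segment is a maximal linear chain in a polyomino chain, including the kinks and/or terminal squares at its ends; its length is its number of squares. The segments of a chain are listed in order along the chain as $S_1,\dots,S_s$, consecutive ones sharing exactly one square (a kink); $S_1,S_s$ are external, and $S_i$ with $2\le i\le s-1$ are internal. $\Omega_n$ denotes the collection of all polyomino chains with $n$ squares in which no internal segment of length three has an edge connecting two vertices of degree three. For a graph $G$ with edge set $E(G)$ and vertex degrees $d_u$: the general Randić index is $R_\gamma(G)=\sum_{uv\in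 E(G)}(d_ud_v)^\gamma$; the general atom-bond connectivity index is $ABC_\gamma(G)=\sum_{uv\in E(G)}\left(\frac{d_u+d_v-2}{d_ud_v}\right)^\gamma$; the general sum-connectivity index is $\chi_\gamma(G)=\sum_{uv\in E(G)}(d_u+d_v)^\gamma$. *)

(* Defs.v *)
From HB Require Import structures.
From mathcomp Require Import all_boot all_order all_algebra.
From mathcomp Require Import finmap reals exp.

Set Implicit Arguments.
Unset Strict Implicit.
Unset Printing Implicit Defensive.

Import Order.TTheory GRing.Theory Num.Theory.
Local Open Scope fset_scope.
Local Open Scope ring_scope.

(* A finite simple graph without isolated vertices is given by its set of
   edges, each edge being the two-element set of its endpoints. *)
Notation graph T := {fset {fset T}}.

Section Graphs.
Variable T : choiceType.
Implicit Types (G : graph T) (A : {fset T}).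

Definition vertices G : {fset T} := \bigcup_(e <- G) e.

Definition edge G : rel T := fun u v => [fset u; v] \in G.

Definition degree G (v : T) : nat := #|` [fset e in G | v \in e] |.

Definition connected_on G A : Prop :=
  forall u v, u \in A -> v \in A ->
  exists p : seq T, [/\ path (edge G) u p, last u p = v & {subset p <= A}].

Definition two_connected G : Prop :=
  [/\ (2 < #|` vertices G |)%N, connected_on G (vertices G)
    & forall x, x \in vertices G -> connected_on G (vertices G `\ x)].

Definition isomorphic G H : Prop :=
  exists f : T -> T,
    [/\ {in vertices G &, injective f}, f @` vertices G = vertices H
      & {in vertices G &, forall u v, edge G u v = edge H (f u) (f v)}].

Section Indices.
Variable R : realType.

(* In the products and sums over [e], [v] ranges over the two endpoints. *)

Definition randic (gamma : R) G : R :=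
  \sum_(e <- G) (\prod_(v <- e) (degree G v)%:R) `^ gamma.

Definition abc (gamma : R) G : R :=
  \sum_(e <- G) ((\sum_(v <- e) (degree G v)%:R - 2)
                 / \prod_(v <- e) (degree G v)%:R) `^ gamma.

Definition sum_conn (gamma : R) G : R :=
  \sum_(e <- G) (\sum_(v <- e) (degree G v)%:R) `^ gamma.

End Indices.
End Graphs.

(* Up to a rigid motion a polyomino system lies on the square lattice.  A point
   is a lattice point; a cell is a unit square of the lattice, represented by
   its lower left corner. *)
Definition point := (int * int)%type.
Definition cell := (int * int)%type.

Definition sides (c : cell) : graph point :=
  let: (x, y) := c in
  [fset [fset (x, y); (x + 1, y)]; [fset (x, y + 1); (x + 1, y + 1)];
        [fset (x, y); (x, y + 1)]; [fset (x + 1, y); (x + 1, y + 1)]].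

Definition corners (c : cell) : {fset point} := vertices (sides c).

Definition adjacent : rel cell :=
  fun c d => (c != d) && (sides c `&` sides d != fset0).

Definition lattice_graph (G : graph point) : Prop :=
  forall e, e \in G -> exists c, e \in sides c.

(* The face of the plane graph [G] containing the interior of [c] is the union
   of the cells that can be reached from [c] by crossing only lattice edges
   that are not in [G]. *)
Definition open_step (G : graph point) : rel cell :=
  fun c d => ~~ (sides c `&` sides d `<=` G).

Definition same_face (G : graph point) (c d : cell) : Prop :=
  exists p : seq cell, path (open_step G) c p /\ last c p = d.

Definition in_interior_face (G : graph point) (c : cell) : Prop :=
  exists N : int, forall d, same_face G c d -> `|d.1| <= N /\ `|d.2| <= N.

Definition polyomino_system (G : graph point) : Prop :=
  [/\ lattice_graph G, two_connected G
    & forall c, in_interior_face G c -> forall d, same_face G c d -> d = c].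

(* In a polyomino system the interior faces are exactly the squares. *)
Definition square (G : graph point) (c : cell) : Prop := in_interior_face G c.

Definition chain_order (G : graph point) (C : seq cell) : Prop :=
  [/\ uniq C, forall c, c \in C <-> square G c
    & forall i j, (i < size C)%N -> (j < size C)%N ->
      adjacent (nth (0, 0) C i) (nth (0, 0) C j) <-> j = i.+1 \/ i = j.+1].

Definition polyomino_chain (n : nat) (G : graph point) : Prop :=
  [/\ polyomino_system G,
      forall c, square G c -> forall s : seq cell, uniq s ->
        (forall d, d \in s -> square G d /\ adjacent c d) -> (size s <= 2)%N
    & exists C, chain_order G C /\ size C = n].

Definition terminal (G : graph point) (c : cell) : Prop :=
  square G c /\ exists! d, square G d /\ adjacent c d.

Definition nonterminal (G : graph point) (c : cell) : Prop :=
  square G c /\ exists d1 d2, [/\ d1 <> d2, square G d1 /\ adjacent c d1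
                                & square G d2 /\ adjacent c d2].

Definition kink (G : graph point) (c : cell) : Prop :=
  nonterminal G c /\ exists v, v \in corners c /\ degree G v = 2%N.

Definition linear_chain (n : nat) (G : graph point) : Prop :=
  polyomino_chain n G /\ forall c, ~ kink G c.

Definition zigzag_chain (n : nat) (G : graph point) : Prop :=
  polyomino_chain n G /\ forall c, square G c -> kink G c \/ terminal G c.

Definition graph_of_cells (s : seq cell) : graph point :=
  \bigcup_(c <- s) sides c.

(* Here and below [a] and [b] are the (0-based) positions, in the list of
   squares [C], of the first and last squares of the subchain. *)
Definition subchain (C : seq cell) (a b : nat) : seq cell :=
  drop a (take b.+1 C).

Definition linear_subchain (C : seq cell) (a b : nat) : Prop :=
  (a <= b < size C)%N /\
  linear_chain (b - a).+1 (graph_of_cells (subchain C a b)).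

Definition segment (C : seq cell) (a b : nat) : Prop :=
  linear_subchain C a b /\
  forall a' b', linear_subchain C a' b' -> (a' <= a)%N -> (b <= b')%N ->
    a' = a /\ b' = b.

(* Neither the first nor the last segment along the chain. *)
Definition internal_segment (C : seq cell) (a b : nat) : Prop :=
  [/\ segment C a b,
      exists a' b', segment C a' b' /\ (a' < a)%N
    & exists a' b', segment C a' b' /\ (a < a')%N].

Definition Omega (n : nat) (G : graph point) : Prop :=
  polyomino_chain n G /\
  forall C a b, chain_order G C -> internal_segment C a b ->
    size (subchain C a b) = 3%N ->
    ~ exists u v, [/\ edge (graph_of_cells (subchain C a b)) u v,
                      degree G u = 3%N & degree G v = 3%N].

Definition extremal_bounds (R : realType) (I : graph point -> R)
    (B L Z : graph point) : Prop :=
  [/\ I L <= I B, I B <= I Z,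
      I B = I L <-> isomorphic B L & I B = I Z <-> isomorphic B Z].

(* Main.v *)
Require Import Defs.
From mathcomp Require Import all_boot all_order all_algebra.
From mathcomp Require Import finmap boolp reals exp.
From mathcomp Require Import zify ring lra.

Set Implicit Arguments.
Unset Strict Implicit.
Unset Printing Implicit Defensive.

Import Order.TTheory GRing.Theory Num.Theory.
Local Open Scope fset_scope.
Local Open Scope ring_scope.

Local Arguments sides : simpl never.

(** Why the theorem holds.  Call an inner square a bend if the chain turns
    there; the bends are the kinks ([kinkP]).  The degree of a vertex of a
    chain is one more than the number of squares around it ([degree_count]), so
    all degrees can be read off from the bends: the outer corners of bends and
    of terminal squares have degree two, the corner of a bend where its two
    shared sides meet has degree four, and the other ends of shared sides have
    degree three.  Write [phi i j] for
    the weight of an edge with end degrees [i] and [j], and [t k] for the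
    indicator of a bend at position [k].  When the bends at the two ends of a
    segment of length three turn to opposite sides, which is what the
    definition of Omega enforces ([Omega_no_U_turn]), every contribution
    depends on two consecutive indicators only, and the index of a chain with
    [m + 3] squares is ([chain_sum])
      const + e (t 1) + e (t (m + 1)) + sum over j of b (t j) (t (j + 1)).
    Three inequalities between the values of [phi] say that [e] and [b]
    increase strictly when a bend is added.  Hence the index is least exactly
    when there is no bend and greatest exactly when every inner square is a
    bend ([chain_value_min], [chain_value_max]), and all chains of either kind
    with the same number of squares differ by a symmetry of the lattice
    ([straight_congruent], [zigzag_congruent]).  The three inequalities follow
    for each index from the convexity or concavity of the power function and
    from the inequality of arithmetic and geometric means.

    The geometric part rests on winding numbers.  In a two-connected graph two
    edges at a vertex lie on a cycle.  Its winding number is constant on faces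
    and zero far away, and it differs by one across an edge that the cycle
    passes, so that each edge has an interior face, that is a square, on at
    least one side ([edge_in_square]), and two squares cannot touch at a corner
    only ([corner_contact]).  This makes the squares around a vertex contiguous
    along the chain ([touches_window]) and gives the degrees. *)

(** * Cells and sides of the square lattice *)

Definition hedge (x y : int) : {fset point} := [fset (x, y); (x + 1, y)].
Definition vedge (x y : int) : {fset point} := [fset (x, y); (x, y + 1)].

Lemma eq_fset2 (T : choiceType) (a b c d : T) :
  ([fset a; b] == [fset c; d]) =
  ((a == c) && (b == d)) || ((a == d) && (b == c)).
Proof.
apply/eqP/idP => [/fsetP E|]; last first.
  by case/orP => /andP[/eqP-> /eqP->] //; rewrite fsetUC.
have := E a; have := E b; have := E c; have := E d; rewrite !inE !eqxx !orbT /=.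
rewrite [d == a]eq_sym [d == b]eq_sym [c == a]eq_sym [c == b]eq_sym.
by do 4![case: (_ == _) => //=].
Qed.

Lemma eq_hedge x y x' y' : (hedge x y == hedge x' y') = (x == x') && (y == y').
Proof. by rewrite eq_fset2 !xpair_eqE; lia. Qed.

Lemma eq_vedge x y x' y' : (vedge x y == vedge x' y') = (x == x') && (y == y').
Proof. by rewrite eq_fset2 !xpair_eqE; lia. Qed.

Lemma hedge_vedge x y x' y' : (hedge x y == vedge x' y') = false.
Proof. by rewrite eq_fset2 !xpair_eqE; lia. Qed.

Lemma vedge_hedge x y x' y' : (vedge x y == hedge x' y') = false.
Proof. by rewrite eq_sym hedge_vedge. Qed.

Definition eq_edges := (eq_hedge, eq_vedge, hedge_vedge, vedge_hedge).

Lemma in_sides e x y : (e \in sides (x, y)) =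
  [|| e == hedge x y, e == hedge x (y + 1), e == vedge x y
    | e == vedge (x + 1) y].
Proof. by rewrite !inE -!orbA. Qed.

Lemma hedge_sides x y (c : cell) :
  (hedge x y \in sides c) = (c == (x, y)) || (c == (x, y - 1)).
Proof. by case: c => a b; rewrite in_sides !eq_edges !xpair_eqE; lia. Qed.

Lemma vedge_sides x y (c : cell) :
  (vedge x y \in sides c) = (c == (x, y)) || (c == (x - 1, y)).
Proof. by case: c => a b; rewrite in_sides !eq_edges !xpair_eqE; lia. Qed.

Lemma in_corners (v : point) (c : cell) : (v \in corners c) =
  ((v.1 == c.1) || (v.1 == c.1 + 1)) && ((v.2 == c.2) || (v.2 == c.2 + 1)).
Proof.
case: c v => x y [a b]; rewrite /corners /vertices.
apply/bigfcupP/idP => [[e]|].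
  rewrite andbT in_sides => /or4P[] /eqP->; rewrite !in_fset2 !xpair_eqE /=; lia.
rewrite /= => H; have [Ea|Na] := eqVneq b y.
  exists (hedge x y); first by rewrite andbT hedge_sides eqxx.
  by rewrite in_fset2 !xpair_eqE; lia.
exists (hedge x (y + 1)); first by rewrite andbT hedge_sides addrK eqxx orbT.
by rewrite in_fset2 !xpair_eqE; lia.
Qed.

Lemma side_corner e v (c : cell) : e \in sides c -> v \in e -> v \in corners c.
Proof. by move=> ec ve; apply/bigfcupP; exists e; rewrite ?andbT. Qed.

Variant shared_side_spec (x y : int) : cell -> {fset point} -> Prop :=
  | SharedDown : shared_side_spec x y (x, y - 1) (hedge x y)
  | SharedUp : shared_side_spec x y (x, y + 1) (hedge x (y + 1))
  | SharedLeft : shared_side_spec x y (x - 1, y) (vedge x y)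
  | SharedRight : shared_side_spec x y (x + 1, y) (vedge (x + 1) y).

Lemma shared_sideP x y (d : cell) e :
  e \in sides (x, y) -> e \in sides d -> (x, y) != d -> shared_side_spec x y d e.
Proof.
rewrite in_sides => /or4P[] /eqP->;
  rewrite ?hedge_sides ?vedge_sides ?addrK => /orP[] /eqP-> //;
  rewrite ?eqxx // => _; constructor.
Qed.

Lemma adjacentE (c d : cell) : adjacent c d =
  ((c.1 == d.1) && ((d.2 == c.2 + 1) || (c.2 == d.2 + 1))) ||
  ((c.2 == d.2) && ((d.1 == c.1 + 1) || (c.1 == d.1 + 1))).
Proof.
case: c => x y; rewrite /adjacent; apply/andP/idP.
  case=> ncd /fset0Pn[e]; rewrite in_fsetI => /andP[ec ed].
  by case: (shared_sideP ec ed ncd) => /=; lia.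
case: d => x' y' /= H; split; first by rewrite xpair_eqE; lia.
have [|||] : [\/ (x', y') = (x, y - 1), (x', y') = (x, y + 1),
               (x', y') = (x - 1, y) | (x', y') = (x + 1, y)].
- have [E|E] := eqVneq x x'.
    have [F|F] := eqVneq y' (y + 1); [constructor 2|constructor 1];
      by congr pair; lia.
  have [F|F] := eqVneq x' (x + 1); [constructor 4|constructor 3];
    by congr pair; lia.
- by case=> -> ->; apply/fset0Pn; exists (hedge x y);
    rewrite in_fsetI !hedge_sides ?eqxx ?orbT.
- by case=> -> ->; apply/fset0Pn; exists (hedge x (y + 1));
    rewrite in_fsetI !hedge_sides ?addrK ?eqxx ?orbT.
- by case=> -> ->; apply/fset0Pn; exists (vedge x y);
    rewrite in_fsetI !vedge_sides ?eqxx ?orbT.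
- by case=> -> ->; apply/fset0Pn; exists (vedge (x + 1) y);
    rewrite in_fsetI !vedge_sides ?addrK ?eqxx ?orbT.
Qed.

Lemma adjacent_sym : symmetric adjacent.
Proof. by move=> c d; rewrite !adjacentE; lia. Qed.

Lemma adjacent_sides c d : adjacent c d ->
  exists e, sides c `&` sides d = [fset e].
Proof.
case: c => x y /andP[ncd /fset0Pn[e]]; rewrite in_fsetI => /andP[ec ed].
exists e; apply/fsetP => e'; rewrite in_fsetI in_fset1; apply/andP/eqP => [[]|->//].
move: ncd ed ec; case: d => x' y' ncd ed ec e'c e'd.
have S1 := shared_sideP ec ed ncd; have S2 := shared_sideP e'c e'd ncd.
by inversion S1; inversion S2; subst => //; lia.
Qed.

(** * Winding numbers of lattice walks *)

Definition lattice_step (u v : point) : bool :=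
  ((u.1 == v.1) && ((v.2 == u.2 + 1) || (u.2 == v.2 + 1))) ||
  ((u.2 == v.2) && ((v.1 == u.1 + 1) || (u.1 == v.1 + 1))).

Fixpoint flow (a b u : point) (p : seq point) : int :=
  if p is v :: p' then
    ((u == a) && (v == b) : nat)%:Z - ((u == b) && (v == a) : nat)%:Z
      + flow a b v p'
  else 0.

(** For a closed walk this is the winding number around the centre of the cell
    [(x, y)], computed from the crossings with the vertical ray that goes up
    from that centre. *)
Fixpoint winding (x y : int) (u : point) (p : seq point) : int :=
  if p is v :: p' then
    ([&& y < u.2, u.1 == x & v.1 == x + 1] : nat)%:Z
      - ([&& y < u.2, u.1 == x + 1 & v.1 == x] : nat)%:Z + winding x y v p'
  else 0.

Variant lattice_step_spec (x y : int) : point -> Prop :=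
  | StepUp : lattice_step_spec x y (x, y + 1)
  | StepDown : lattice_step_spec x y (x, y - 1)
  | StepRight : lattice_step_spec x y (x + 1, y)
  | StepLeft : lattice_step_spec x y (x - 1, y).

Lemma lattice_stepP x y v : lattice_step (x, y) v -> lattice_step_spec x y v.
Proof.
case: v => a b; rewrite /lattice_step /= => H.
have [E|E] := eqVneq x a.
  have [F|F] := eqVneq b (y + 1).
    rewrite F -E; constructor.
  have -> : (a, b) = (x, y - 1) by congr pair; lia.
  constructor.
have [F|F] := eqVneq a (x + 1).
  have -> : (a, b) = (x + 1, y) by congr pair; lia.
  constructor.
have -> : (a, b) = (x - 1, y) by congr pair; lia.
constructor.
Qed.

(** The counted booleans together give too many cases for [lia]. *)
Local Ltac split_counts := repeat match goal with |- context [nat_of_bool ?b] =>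
  let E := fresh "E" in
  first [ have E : b = false by (clear; lia) | have E : b = true by (clear; lia)
        | case E : b ]; rewrite ?E /= end.

(** Moving the centre up past a horizontal edge only loses the crossings of
    that edge. *)
Lemma winding_up x y u p : path lattice_step u p ->
  winding x y u p - winding x (y + 1) u p
    = flow (x, y + 1) (x + 1, y + 1) u p.
Proof.
elim: p u => [|v p IH] [a b] //= /andP[uv /IH <-].
move: (winding _ _ _ _) (winding _ _ _ _) => w w'.
by case: (lattice_stepP uv); rewrite !xpair_eqE /=; split_counts; lia.
Qed.

(** Each step of the walk that enters or leaves the upward ray from
    [(x + 1, y + 1)] crosses one of the two vertical rays or passes along the
    edge that separates the two cells; a closed walk enters as often as it
    leaves. *)
Lemma winding_right x y u p : path lattice_step u p ->
  winding x y u p - winding (x + 1) y u p + flow (x + 1, y) (x + 1, y + 1) u p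
    = (((last u p).1 == x + 1) && (y < (last u p).2) : nat)%:Z
      - ((u.1 == x + 1) && (y < u.2) : nat)%:Z.
Proof.
elim: p u => [|v p IH] [a b] /=; first by rewrite !subrr.
case/andP=> uv /IH; move: (last v p) => l.
move: (winding _ _ _ _) (winding _ _ _ _) (flow _ _ _ _) => w w' f.
move: ((l.1 == _) && _) => g.
by case: (lattice_stepP uv); rewrite !xpair_eqE /=; split_counts; lia.
Qed.

Lemma winding_far x y (N : int) u p : path lattice_step u p -> last u p = u ->
    (forall v, v \in u :: p -> `|v.1| <= N /\ `|v.2| <= N) ->
  winding x y u p != 0 -> `|x| <= N + 1 /\ `|y| <= N + 1.
Proof.
move=> up cl box.
have above : N <= y -> winding x y u p = 0.
  move=> Ny; elim: p u box {up cl} => //= v p IH u box.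
  rewrite IH => [|w wp]; last by apply: box; rewrite inE wp orbT.
  have [] := box u (mem_head _ _); lia.
have aside : N < x \/ x < - N - 1 -> winding x y u p = 0.
  move=> Nx; elim: p u box {up cl above} => //= v p IH u box.
  rewrite IH => [|w wp]; last by apply: box; rewrite inE wp orbT.
  have [] := box u (mem_head _ _); lia.
(* Here all horizontal steps in the column count, so that the sum telescopes. *)
have below : y < - N -> winding x y u p = 0.
  move=> yN; suff : winding x y u p
      = (nat_of_bool (x < (last u p).1))%:Z - (nat_of_bool (x < u.1))%:Z by rewrite cl; lia.
  elim: p u box up {cl above aside} => [|v p IH] u box /=; first by rewrite subrr.
  case/andP=> uv vp; rewrite (IH v) //; last first.
    by move=> w wp; apply: box; rewrite inE wp orbT.
  have [_ u2] := box u (mem_head _ _); case: u uv u2 {box} => a b uv /= u2.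
  have -> : y < b by lia.
  by case: (lattice_stepP uv) => /=; split_counts; lia.
move=> nz; split.
- have [H|H] := boolP (`|x| <= N + 1); first by [].
  have Nx : N < x \/ x < - N - 1 by lia.
  by move: nz; rewrite aside.
- have [H|H] := boolP (`|y| <= N + 1); first by [].
  have [yN|yN] := ltP y (- N); first by move: nz; rewrite below.
  have Ny : N <= y by lia.
  by move: nz; rewrite above.
Qed.

Lemma walk_box (u : point) p : exists N : int,
  forall v, v \in u :: p -> `|v.1| <= N /\ `|v.2| <= N.
Proof.
elim: (u :: p) => [|[a b] s [N HN]]; first by exists 0.
exists (N + `|N| + `|a| + `|b|) => v; rewrite inE => /orP[/eqP->|/HN[]].
  by rewrite /=; split; lia.
by case: v => c d /= Hc Hd; split; lia.
Qed.

(** * Faces of a polyomino system *)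

Lemma edge_sym G : symmetric (@edge point G).
Proof. by move=> u v; rewrite /edge fsetUC. Qed.

Lemma edge_vertices (G : graph point) u v :
  edge G u v -> u \in vertices G /\ v \in vertices G.
Proof.
by move=> uv; split; apply/bigfcupP; exists [fset u; v];
  rewrite ?andbT // in_fset2 eqxx ?orbT.
Qed.

Lemma sides_edge c e : e \in sides c ->
  (exists x y, e = hedge x y) \/ (exists x y, e = vedge x y).
Proof.
case: c => x y; rewrite in_sides => /or4P[] /eqP->.
- by left; exists x, y.
- by left; exists x, (y + 1).
- by right; exists x, y.
- by right; exists (x + 1), y.
Qed.

Lemma lattice_edge G u v : lattice_graph G -> edge G u v -> lattice_step u v.
Proof.
move=> GL /GL[c] /sides_edge[] [x [y /eqP]]; rewrite eq_fset2;
  case: u v => a b [a' b']; rewrite !xpair_eqE /lattice_step /=; lia.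
Qed.

Lemma lattice_walk G u p :
  lattice_graph G -> path (edge G) u p -> path lattice_step u p.
Proof. by move=> GL; apply: sub_path => a b; apply: lattice_edge. Qed.

Lemma flow_sym a b u p : flow a b u p = - flow b a u p.
Proof. by elim: p u => [|v p IH] u //=; rewrite IH; lia. Qed.

Lemma flow_missing G a b u p :
  path (edge G) u p -> ~~ edge G a b -> flow a b u p = 0.
Proof.
move=> + nab; elim: p u => //= v p IH u /andP[uv /IH->].
have [/andP[/eqP Ea /eqP Eb]|_] := boolP (_ && _).
  by rewrite -Ea -Eb uv in nab.
have [/andP[/eqP Ea /eqP Eb]|_] := boolP (_ && _); last by [].
by rewrite -Ea -Eb edge_sym uv in nab.
Qed.

Section Walks.
Variables (G : graph point) (u : point) (p : seq point).
Hypotheses (GL : lattice_graph G) (up : path (edge G) u p) (cl : last u p = u).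

Lemma winding_open_step c d :
  open_step G c d -> winding c.1 c.2 u p = winding d.1 d.2 u p.
Proof.
have lp := lattice_walk GL up.
case/fsubsetPn => e; rewrite in_fsetI => /andP[ec ed] eG.
have [->//|ncd] := eqVneq c d.
case: c ec ncd => x y ec ncd; case: (shared_sideP ec ed ncd) eG => eG /=.
- have := winding_up x (y - 1) lp; rewrite subrK (flow_missing up) //; lia.
- have := winding_up x y lp; rewrite (flow_missing up) //; lia.
- have := winding_right (x - 1) y lp; rewrite subrK cl (flow_missing up) //; lia.
- have := winding_right x y lp; rewrite cl (flow_missing up) //; lia.
Qed.

(** The winding number is constant on the faces of [G] and vanishes far
    away. *)
Lemma winding_interior c : winding c.1 c.2 u p != 0 -> in_interior_face G c.
Proof.
move=> nz; have [N boxN] := walk_box u p.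
exists (N + 1) => d [q [cq <-]]; apply: winding_far boxN _ => //.
  exact: lattice_walk up.
elim: q c nz cq => //= d' q IH c nz /andP[cd']; apply: IH.
by rewrite -(winding_open_step cd').
Qed.

End Walks.

(** Since [v] is not a cut vertex, two edges at [v] lie on a cycle; it passes
    no other edge at [v]. *)
Lemma closed_walk_at G v w w' :
    lattice_graph G -> two_connected G -> edge G v w -> edge G v w' -> w != w' ->
  exists p, [/\ path (edge G) v p, last v p = v
    & forall z, flow v z v p = (w == z : nat)%:Z - (w' == z : nat)%:Z].
Proof.
move=> GL [_ _ cG] vw vw' nww'.
have [vG wG] := edge_vertices vw; have [_ w'G] := edge_vertices vw'.
have neq z : edge G v z -> (z == v) = false.
  by move/(lattice_edge GL); case: v z {vw vw' cG vG} => a b [c d];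
    rewrite /lattice_step xpair_eqE /=; lia.
have [||q [wq lq qG]] := cG _ vG w w'; rewrite ?in_fsetD1 ?neq //.
exists (w :: rcons q v); split.
- by rewrite /= vw rcons_path wq lq edge_sym.
- by rewrite /= last_rcons.
move=> z; rewrite /= eqxx /= (neq _ vw) andbF subr0; congr (_ + _).
have : v \notin w :: q.
  by rewrite inE eq_sym neq //=; apply/negP => /qG; rewrite in_fsetD1 eqxx.
elim: q w lq {vw nww' wG wq qG} => [|x q IH] w /=.
  by move=> -> _; rewrite eqxx neq // andbT /= sub0r addr0.
move=> lq; rewrite inE negb_or eq_sym => /andP[/negPf-> vq].
rewrite IH //; have : x == v = false; last by move->; rewrite andbF; lia.
by move: vq; rewrite inE negb_or eq_sym => /andP[/negPf].
Qed.

(** Some third vertex remains connected to [v] when [z] is removed. *)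
Lemma second_edge G v z :
  lattice_graph G -> two_connected G -> edge G v z ->
  exists2 z', z != z' & edge G v z'.
Proof.
move=> GL [VG _ cG] vz; have [vG zG] := edge_vertices vz.
have nvz : v != z.
  by move: (lattice_edge GL vz); case: v z {vG zG vz} => a b [c d];
    rewrite /lattice_step xpair_eqE /=; lia.
have [t tG] : exists t, t \in vertices G `\ z `\ v.
  apply/fset0Pn; rewrite -cardfs_gt0.
  by rewrite -ltnS (cardfsD1 z) zG (cardfsD1 v) in_fsetD1 nvz vG in VG.
move: tG; rewrite !in_fsetD1 => /and3P[ntv ntz tG].
have [||[|x q] [/= ]] := cG _ zG v t; rewrite ?in_fsetD1 ?nvz ?ntz //.
  by move=> _ E; rewrite E eqxx in ntv.
case/andP=> vx _ _ /(_ x (mem_head _ _)); rewrite in_fsetD1 => /andP[nxz _].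
by exists x; rewrite // eq_sym.
Qed.

Lemma sides_square (G : graph point) c : sides c `<=` G -> square G c.
Proof.
move=> cG; exists (`|c.1| + `|c.2|) => d [[|d' q] [/=]].
  by move=> _ <-; case: c {cG} => a b /=; split; lia.
by rewrite /open_step (fsubset_trans (fsubsetIl _ _) cG).
Qed.

Section System.
Variable G : graph point.
Hypothesis PG : polyomino_system G.

Let GL : lattice_graph G. Proof. by case: PG. Qed.
Let G2 : two_connected G. Proof. by case: PG. Qed.

(** An open side would put the neighbouring cell into the same face. *)
Lemma squareP c : square G c <-> sides c `<=` G.
Proof.
split; last exact: sides_square.
move=> sc; apply/fsubsetP => e ec; apply/negPn/negP => eG.
suff [d ed ncd] : exists2 d, e \in sides d & c != d.
  case: PG => _ _ /(_ c sc d) H; move/eqP: ncd; apply; apply/esym/H.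
  exists [:: d]; split => //=; rewrite andbT; apply/fsubsetPn; exists e => //.
  by rewrite in_fsetI ec.
case: c ec {sc} => x y; rewrite in_sides => /or4P[] /eqP-> {e eG}.
- exists (x, y - 1); first by rewrite hedge_sides eqxx orbT.
  by rewrite xpair_eqE; lia.
- exists (x, y + 1); first by rewrite hedge_sides eqxx.
  by rewrite xpair_eqE; lia.
- exists (x - 1, y); first by rewrite vedge_sides eqxx orbT.
  by rewrite xpair_eqE; lia.
- exists (x + 1, y); first by rewrite vedge_sides eqxx.
  by rewrite xpair_eqE; lia.
Qed.

(** A cycle through the edge has winding numbers that differ by one on its
    two sides, so that one of the two faces is interior. *)
Lemma edge_in_square e : e \in G -> exists2 c, square G c & e \in sides c.
Proof.
move=> eG; have [c /sides_edge[] [x [y Ee]]] := GL eG; rewrite Ee in eG *.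
  have [z nz vz] := second_edge GL G2 (eG : edge G (x, y) (x + 1, y)).
  have [p [vp lp fp]] := closed_walk_at GL G2 eG vz nz.
  have := winding_up x (y - 1) (lattice_walk GL vp).
  rewrite subrK fp eqxx eq_sym (negPf nz) => E.
  have [Z|Z] := eqVneq (winding x y (x, y) p) 0; last first.
    by exists (x, y); [apply: (winding_interior GL vp lp) | rewrite hedge_sides eqxx].
  exists (x, y - 1); last by rewrite hedge_sides eqxx orbT.
  by apply: (winding_interior GL vp lp); rewrite /=; lia.
have [z nz vz] := second_edge GL G2 (eG : edge G (x, y) (x, y + 1)).
have [p [vp lp fp]] := closed_walk_at GL G2 eG vz nz.
have := winding_right (x - 1) y (lattice_walk GL vp).
rewrite subrK lp fp eqxx eq_sym (negPf nz) => E.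
have [Z|Z] := eqVneq (winding x y (x, y) p) 0; last first.
  by exists (x, y); [apply: (winding_interior GL vp lp) | rewrite vedge_sides eqxx].
exists (x - 1, y); last by rewrite vedge_sides eqxx orbT.
by apply: (winding_interior GL vp lp); rewrite /=; lia.
Qed.

(** Of the four cells around a vertex with edges to the left and to the right,
    a cycle through these edges separates the upper two from the lower two, and
    on each diagonal there is one of either kind. *)
Lemma opposite_edges x y : hedge x y \in G -> hedge (x - 1) y \in G ->
  (square G (x, y) \/ square G (x - 1, y - 1)) /\
  (square G (x - 1, y) \/ square G (x, y - 1)).
Proof.
move=> eE eW.
have vW : edge G (x, y) (x - 1, y) by rewrite edge_sym /edge -{2}(subrK 1 x).
have [|p [vp lp fp]] := closed_walk_at GL G2 (eE : edge G (x, y) (x + 1, y)) vW.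
  by rewrite xpair_eqE; lia.
have wp := lattice_walk GL vp.
have E1 := winding_up x (y - 1) wp; have E2 := winding_right (x - 1) y wp.
have E3 := winding_right (x - 1) (y - 1) wp.
move: E1 E2 E3; rewrite !subrK lp [flow (x, y - 1) _ _ _]flow_sym !fp !xpair_eqE.
set ne := winding x y _ _; set nw := winding (x - 1) y _ _.
set se := winding x (y - 1) _ _; set sw := winding (x - 1) (y - 1) _ _.
move=> E1 E2 E3; have interior := winding_interior GL vp lp.
split.
  have [Z|Z] := eqVneq ne 0; [right|left; exact: interior].
  by apply: interior; rewrite -/sw /=; lia.
have [Z|Z] := eqVneq nw 0; [right|left; exact: interior].
by apply: interior; rewrite -/se /=; lia.
Qed.

End System.

(** * Corners of a cell and of its neighbours *)

(** The corners of [m] in cyclic order; [perm_eq] serves for membership as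
    well as for sums over the sides. *)
Definition quad (m : cell) (p q o s : point) : Prop :=
  perm_eq (sides m) [:: [fset p; q]; [fset q; o]; [fset o; s]; [fset s; p]] /\
  perm_eq (corners m) [:: p; q; o; s].

Lemma quad_rot m p q o s : quad m p q o s -> quad m q o s p.
Proof.
have rot4 (T : eqType) (a b c d : T) : perm_eq [:: a; b; c; d] [:: b; c; d; a].
  by rewrite perm_sym -[X in perm_eq X]/(rot 1 [:: a; b; c; d]) perm_rot.
by case=> S K; split; [apply: (perm_trans S) | apply: (perm_trans K)]; exact: rot4.
Qed.

Lemma quad_flip m p q o s : quad m p q o s -> quad m q p s o.
Proof.
have flip4 (T : eqType) (a b c d : T) : perm_eq [:: a; b; c; d] [:: a; d; c; b].
  by rewrite perm_cons -[X in perm_eq X]/(rev [:: d; c; b]) perm_rev.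
have swap4 (T : eqType) (a b c d : T) : perm_eq [:: a; b; c; d] [:: b; a; d; c].
  by apply: (@perm_cat _ [:: a; b] [:: b; a]); rewrite (perm_catC [:: _] [:: _]).
case=> S K; split; last by apply: (perm_trans K); apply: swap4.
rewrite [[fset q; p]]fsetUC [[fset p; s]]fsetUC [[fset s; o]]fsetUC.
by rewrite [[fset o; q]]fsetUC; apply: (perm_trans S); apply: flip4.
Qed.

Lemma quad_cell x y :
  quad (x, y) (x, y) (x + 1, y) (x + 1, y + 1) (x, y + 1).
Proof.
split; apply: uniq_perm; rewrite ?fset_uniq //.
- by rewrite /= !inE !eq_fset2 !xpair_eqE; lia.
- move=> e; rewrite in_sides !inE /hedge /vedge.
  rewrite [[fset (x + 1, y + 1); (x, y + 1)]]fsetUC.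
  rewrite [[fset (x, y + 1); (x, y)]]fsetUC.
  by move: (e == _) (e == _) (e == _) (e == _) => [] [] [] [].
- by rewrite /= !inE !xpair_eqE; lia.
- by move=> [a b]; rewrite in_corners !inE !xpair_eqE /=; lia.
Qed.

Definition turns (a b : cell) : bool := (a.1 != b.1) && (a.2 != b.2).

Lemma adjacent_shared x y d :
  adjacent (x, y) d -> exists e, shared_side_spec x y d e.
Proof.
case/andP=> ncd /fset0Pn[e]; rewrite in_fsetI => /andP[ec ed].
by exists e; apply: shared_sideP.
Qed.

Lemma quad_end m b : adjacent m b -> exists p q o s, quad m p q o s /\
  [/\ p \in corners b, q \in corners b, o \notin corners b
    & s \notin corners b].
Proof.
case: m => x y /adjacent_shared[e []]; have Q := quad_cell x y.
- exists (x, y), (x + 1, y), (x + 1, y + 1), (x, y + 1).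
  by split=> //; rewrite !in_corners /=; split; lia.
- exists (x + 1, y + 1), (x, y + 1), (x, y), (x + 1, y).
  split; first by do 2!apply: quad_rot.
  by rewrite !in_corners /=; split; lia.
- exists (x, y + 1), (x, y), (x + 1, y), (x + 1, y + 1).
  split; first by do 3!apply: quad_rot.
  by rewrite !in_corners /=; split; lia.
- exists (x + 1, y), (x + 1, y + 1), (x, y + 1), (x, y).
  split; first exact: quad_rot.
  by rewrite !in_corners /=; split; lia.
Qed.

(** With [quad_middle] the lattice directions disappear: the side shared with
    [a] is always [[fset p; q]], and the side shared with [b] is [[fset s; p]]
    at a turn and [[fset o; s]] otherwise. *)
Variant quad_middle_spec (a m b : cell) (p q o s : point) : bool -> Prop :=
  | QuadTurn of p \in corners b & q \notin corners b & o \notin corners b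
      & s \in corners b : quad_middle_spec a m b p q o s true
  | QuadStraight of p \notin corners b & q \notin corners b & o \in corners b
      & s \in corners b : quad_middle_spec a m b p q o s false.

Local Ltac place := rewrite ?in_corners /turns /=; try split; lia.

Lemma quad_middle a m b : adjacent m a -> adjacent m b -> a != b ->
  exists p q o s, [/\ quad m p q o s,
    [/\ p \in corners a, q \in corners a, o \notin corners a
      & s \notin corners a]
    & quad_middle_spec a m b p q o s (turns a b)].
Proof.
case: m => x y ma mb nab.
have Q1 := quad_cell x y; have Q2 := quad_rot Q1.
have Q3 := quad_rot Q2; have Q4 := quad_rot Q3.
have Q5 := quad_flip Q1; have Q6 := quad_flip Q2.
have Q7 := quad_flip Q3; have Q8 := quad_flip Q4.
have [e1 S1] := adjacent_shared ma; have [e2 S2] := adjacent_shared mb.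
have turn u v w t : quad (x, y) u v w t ->
    [/\ u \in corners a, v \in corners a, w \notin corners a
      & t \notin corners a] ->
    [/\ u \in corners b, v \notin corners b, w \notin corners b
      & t \in corners b] -> turns a b ->
  exists p q o s, [/\ quad (x, y) p q o s,
    [/\ p \in corners a, q \in corners a, o \notin corners a
      & s \notin corners a]
    & quad_middle_spec a (x, y) b p q o s (turns a b)].
  by move=> Q Ha [? ? ? ?] ->; exists u, v, w, t; split=> //; constructor.
have straight u v w t : quad (x, y) u v w t ->
    [/\ u \in corners a, v \in corners a, w \notin corners a
      & t \notin corners a] ->
    [/\ u \notin corners b, v \notin corners b, w \in corners b
      & t \in corners b] -> turns a b = false ->
  exists p q o s, [/\ quad (x, y) p q o s,
    [/\ p \in corners a, q \in corners a, o \notin corners a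
      & s \notin corners a]
    & quad_middle_spec a (x, y) b p q o s (turns a b)].
  by move=> Q Ha [? ? ? ?] ->; exists u, v, w, t; split=> //; constructor.
case: S1 ma nab turn straight => _ nab turn straight;
  case: S2 mb nab turn straight => _ nab turn straight;
  rewrite ?eqxx // in nab *.
- apply: (straight _ _ _ _ Q1); place.
- apply: (turn _ _ _ _ Q1); place.
- apply: (turn _ _ _ _ Q5); place.
- apply: (straight _ _ _ _ Q3); place.
- apply: (turn _ _ _ _ Q7); place.
- apply: (turn _ _ _ _ Q3); place.
- apply: (turn _ _ _ _ Q8); place.
- apply: (turn _ _ _ _ Q4); place.
- apply: (straight _ _ _ _ Q4); place.
- apply: (turn _ _ _ _ Q2); place.
- apply: (turn _ _ _ _ Q6); place.
- apply: (straight _ _ _ _ Q2); place.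
Qed.

(** Both ends of a shared side are corners of [a], and no other side of [m] has
    both ends there. *)
Lemma quad_shared a m p q o s e : quad m p q o s ->
    o \notin corners a -> s \notin corners a ->
  e \in sides a -> e \in sides m -> e = [fset p; q].
Proof.
case=> /perm_mem S _ oa sa ea; rewrite S !inE.
have no z : z \notin corners a -> z \notin e by apply: contra; apply: side_corner.
by case/or4P=> /eqP E //; have := no _ oa; have := no _ sa;
  rewrite E !in_fset2 ?eqxx ?orbT.
Qed.

(** * Vertex degrees in a polyomino chain *)

Lemma degree_edges (G : graph point) x y : lattice_graph G ->
  degree G (x, y) = ((hedge x y \in G) + (hedge (x - 1)%R y \in G)
    + (vedge x y \in G) + (vedge x (y - 1)%R \in G))%N.
Proof.
move=> GL; rewrite /degree.
set s := [:: hedge x y; hedge (x - 1) y; vedge x y; vedge x (y - 1)].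
have /perm_size -> : perm_eq [fset e in G | (x, y) \in e] [seq e <- s | e \in G].
  apply: uniq_perm; rewrite ?fset_uniq ?filter_uniq //.
    by rewrite /s /= !inE !eq_edges; lia.
  move=> e; rewrite !inE mem_filter; case: (boolP (e \in G)) => //= eG.
  have [c /sides_edge[] [a [b ->]]] := GL _ eG;
    rewrite /s !inE !eq_edges ?in_fset2 !xpair_eqE; lia.
by rewrite size_filter /s /= !addnA addn0.
Qed.

(** Otherwise the other two cells around [v] would both be exterior, against
    [opposite_edges]. *)
Lemma corner_contact (G : graph point) v a b : polyomino_system G ->
    square G a -> square G b -> v \in corners a -> v \in corners b ->
    turns a b ->
  exists d, [/\ square G d, v \in corners d, adjacent a d & adjacent b d].
Proof.
move=> PG Ga Gb va vb ab; have sG c : square G c -> sides c `<=` G.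
  by move=> /(squareP PG).
have edges x y a' b' : square G a' -> square G b' -> turns a' b' ->
  (x, y) \in corners a' -> (x, y) \in corners b' ->
  a'.2 = y -> hedge x y \in G /\ hedge (x - 1) y \in G.
  move=> /sG/fsubsetP Ga' /sG/fsubsetP Gb'.
  rewrite !in_corners /turns; case: a' b' Ga' Gb' => a1 a2 [b1 b2] /=.
  move=> Ga' Gb' tn xa xb E; have [Ex|Nx] := eqVneq x a1.
    have Eb : (b1, b2) = (x - 1, y - 1) by congr pair; lia.
    by split; [apply: Ga'|apply: Gb']; rewrite hedge_sides ?Eb ?Ex ?E ?eqxx ?orbT.
  have Eb : (b1, b2) = (x, y - 1) by congr pair; lia.
  have Ea : a1 = x - 1 by lia.
  by split; [apply: Gb'|apply: Ga']; rewrite hedge_sides ?Eb ?Ea ?E ?eqxx ?orbT.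
case: v va vb => x y va vb.
have [eE eW] : hedge x y \in G /\ hedge (x - 1) y \in G.
  have [E|N] := eqVneq a.2 y; first exact: edges ab va vb E.
  apply: (edges x y b a) => //; first by rewrite /turns [b.1 == _]eq_sym [b.2 == _]eq_sym.
  by move: ab va vb; rewrite /turns !in_corners /=; case: a b {Ga Gb} N => ? ? [? ?] /=; lia.
have [D1 D2] := opposite_edges PG eE eW.
have [d [Gd vd da db]] : exists d, [/\ square G d, (x, y) \in corners d,
    turns a d = false & turns b d = false /\ d != a /\ d != b].
  move: ab va vb; rewrite /turns !in_corners; case: a b {Ga Gb} => a1 a2 [b1 b2].
  rewrite /= => ab va vb; have [E|N] := boolP ((a1 == x) == (a2 == y)).
    by case: D2 => Gd; eexists; (split; first exact: Gd);
      rewrite ?in_corners ?xpair_eqE /=; do ?split; lia.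
  by case: D1 => Gd; eexists; (split; first exact: Gd);
    rewrite ?in_corners ?xpair_eqE /=; do ?split; lia.
exists d; rewrite !adjacentE; split=> //.
  move: va vd da db; rewrite /turns !in_corners; case: a b d {Ga Gb ab vb Gd} => a1 a2 [b1 b2] [d1 d2].
  by rewrite !xpair_eqE /= => va vd da [db [nda ndb]]; lia.
move: vb vd da db; rewrite /turns !in_corners; case: a b d {Ga Gb ab va Gd} => a1 a2 [b1 b2] [d1 d2].
by rewrite !xpair_eqE /= => va vd da [db [nda ndb]]; lia.
Qed.

Definition touches (C : seq cell) (v : point) (k : nat) : bool :=
  (k < size C)%N && (v \in corners (nth (0, 0) C k)).

(** False at the two terminal cells, so that every position has an indicator. *)
Definition bend (C : seq cell) (k : nat) : bool :=
  [&& (0 < k)%N, (k.+1 < size C)%N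
    & turns (nth (0, 0) C k.-1) (nth (0, 0) C k.+1)].

Section Chain.
Variables (G : graph point) (C : seq cell).
Hypotheses (PG : polyomino_system G) (CO : chain_order G C).
Local Notation c := (nth (0, 0) C).
Local Notation n := (size C).

Lemma chain_uniq : uniq C. Proof. by case: CO. Qed.

Lemma chain_square d : square G d <-> d \in C.
Proof. by case: CO => _ sC _; split=> /sC. Qed.

Lemma chain_adjacent i j : (i < n)%N -> (j < n)%N ->
  adjacent (c i) (c j) = (j == i.+1) || (i == j.+1).
Proof.
move=> ni nj; case: CO => _ _ /(_ i j ni nj)[A1 A2]; apply/idP/idP.
  by case/A1=> ->; rewrite eqxx ?orbT.
by move=> H; apply: A2; case/orP: H => /eqP; [left|right].
Qed.

Lemma chain_edge e : (e \in G) = has (fun d => e \in sides d) C.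
Proof.
apply/idP/hasP => [/(edge_in_square PG)[d sd ed]|[d]].
  by exists d => //; apply/chain_square.
by move=> /chain_square/(squareP PG)/fsubsetP; apply.
Qed.

(** Two cells that share a corner are at most two positions apart: otherwise
    they would touch at that corner only. *)
Lemma touches_window v i j : (i < j)%N -> touches C v i -> touches C v j ->
  j = i.+1 \/ j = i.+2 /\ touches C v i.+1.
Proof.
move=> ij /andP[ni vi] /andP[nj vj].
have neq : c i != c j by rewrite nth_uniq ?chain_uniq //; lia.
have [T|T] := boolP (turns (c i) (c j)).
  have [||d [/chain_square dC vd id jd]] := corner_contact PG _ _ vi vj T.
  - by apply/chain_square/mem_nth.
  - by apply/chain_square/mem_nth.
  move/(nthP (0, 0)): dC vd id jd => [k nk <-] vd.
  rewrite !chain_adjacent // => ik jk; right.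
  have Ek : k = i.+1 by lia.
  by rewrite /touches -Ek nk vd; split; first lia.
have : adjacent (c i) (c j).
  move: T neq vi vj; rewrite /turns adjacentE !in_corners.
  by case: (c i) (c j) v => a b [a' b'] [x y]; rewrite xpair_eqE /=; lia.
by rewrite chain_adjacent //; left; lia.
Qed.

Lemma touches_far v k : touches C v k -> touches C v k.+3 -> false.
Proof. by move=> t0 t3; case: (touches_window _ t0 t3) => [||[]]; lia. Qed.

Lemma count_corner v : count (fun d => v \in corners d) C
  = (((v.1, v.2) \in C) + ((v.1 - 1, v.2)%R \in C) + ((v.1 - 1, v.2 - 1)%R \in C)
    + ((v.1, v.2 - 1)%R \in C))%N.
Proof.
case: v => x y /=; elim: C chain_uniq => //= d s IH /andP[ds /IH ->].
rewrite in_corners !in_cons; case: d ds => a b ds.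
have split_in z : (((z == (a, b)) || (z \in s)) = ((z == (a, b)) + (z \in s)) :> nat)%N.
  by have [->|] := eqVneq z (a, b); rewrite ?(negPf ds).
rewrite !split_in.
have -> : nat_of_bool (((x == a) || (x == a + 1)) && ((y == b) || (y == b + 1)))
    = (((x, y) == (a, b)) + ((x - 1, y)%R == (a, b))
       + ((x - 1, y - 1)%R == (a, b)) + ((x, y - 1)%R == (a, b)))%N.
  by rewrite !xpair_eqE; clear; lia.
move: (nat_of_bool (_ == _)) (nat_of_bool (_ == _)) (nat_of_bool (_ == _)).
move: (nat_of_bool (_ == _)) (nat_of_bool (_ \in s)) (nat_of_bool (_ \in s)).
move: (nat_of_bool (_ \in s)) (nat_of_bool (_ \in s)).
by clear; lia.
Qed.

(** Around a vertex the cells of the chain are contiguous and leave a gap, so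
    that they are separated by one edge less than meet there. *)
Lemma degree_count v k : touches C v k ->
  degree G v = (count (fun d => v \in corners d) C).+1.
Proof.
case/andP=> nk vk; rewrite count_corner.
case: v vk => x y vk; rewrite (degree_edges _ _ (let: And3 L _ _ := PG in L)).
have has2 (a b : cell) : has (fun d => (d == a) || (d == b)) C = (a \in C) || (b \in C).
  apply/hasP/orP => [[d dC /orP[/eqP <-|/eqP <-]]|[]]; [by left|by right| |].
    by move=> aC; exists a; rewrite ?eqxx.
  by move=> bC; exists b; rewrite ?eqxx ?orbT.
have hE a b : (hedge a b \in G) = ((a, b) \in C) || ((a, b - 1) \in C).
  by rewrite chain_edge -has2; apply: eq_has => d; rewrite hedge_sides.
have vE a b : (vedge a b \in G) = ((a, b) \in C) || ((a - 1, b) \in C).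
  by rewrite chain_edge -has2; apply: eq_has => d; rewrite vedge_sides.
rewrite !hE !vE /=.
have corner a b : a \in C -> b \in C -> (x, y) \in corners a -> (x, y) \in corners b ->
    turns a b -> exists d, [/\ d \in C, (x, y) \in corners d, adjacent a d & adjacent b d].
  move=> aC bC va vb T; have [||d [/chain_square]] := corner_contact PG _ _ va vb T.
  - exact/chain_square.
  - exact/chain_square.
  by exists d.
have diag1 : (x, y) \in C -> (x - 1, y - 1) \in C ->
    ((x - 1, y) \in C) || ((x, y - 1) \in C).
  move=> aC bC; have [|||[a b] [dC vd ad bd]] := corner _ _ aC bC.
  - by rewrite in_corners /=; lia.
  - by rewrite in_corners /=; lia.
  - by rewrite /turns /=; lia.
  move: vd ad bd; rewrite in_corners !adjacentE /= => vd ad bd.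
  have [E|E] : (a, b) = (x - 1, y) \/ (a, b) = (x, y - 1).
    have [Ea|Na] := eqVneq a x; [right|left]; congr pair; lia.
  - by rewrite -E dC.
  - by rewrite -E dC orbT.
have diag2 : (x - 1, y) \in C -> (x, y - 1) \in C ->
    ((x, y) \in C) || ((x - 1, y - 1) \in C).
  move=> aC bC; have [|||[a b] [dC vd ad bd]] := corner _ _ aC bC.
  - by rewrite in_corners /=; lia.
  - by rewrite in_corners /=; lia.
  - by rewrite /turns /=; lia.
  move: vd ad bd; rewrite in_corners !adjacentE /= => vd ad bd.
  have [E|E] : (a, b) = (x, y) \/ (a, b) = (x - 1, y - 1).
    have [Ea|Na] := eqVneq a x; [left|right]; congr pair; lia.
  - by rewrite -E dC.
  - by rewrite -E dC orbT.
have four : (x, y) \in C -> (x - 1, y) \in C -> (x - 1, y - 1) \in C ->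
    (x, y - 1) \in C -> False.
  move=> /(nthP (0, 0))[i1 n1 E1] /(nthP (0, 0))[i2 n2 E2].
  move=> /(nthP (0, 0))[i3 n3 E3] /(nthP (0, 0))[i4 n4 E4].
  have a12 : adjacent (c i1) (c i2) by rewrite E1 E2 adjacentE /=; lia.
  have a14 : adjacent (c i1) (c i4) by rewrite E1 E4 adjacentE /=; lia.
  have a32 : adjacent (c i3) (c i2) by rewrite E3 E2 adjacentE /=; lia.
  have a34 : adjacent (c i3) (c i4) by rewrite E3 E4 adjacentE /=; lia.
  have n13 : i1 <> i3 by move=> E; move: E1; rewrite E E3 => -[]; lia.
  have n24 : i2 <> i4 by move=> E; move: E2; rewrite E E4 => -[]; lia.
  by move: a12 a14 a32 a34; rewrite !chain_adjacent //; lia.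
move: (mem_nth (0, 0) nk) vk diag1 diag2 four; case: (c k) => a b abC.
rewrite in_corners /= => vk.
have : [|| (x, y) \in C, (x - 1, y) \in C, (x - 1, y - 1) \in C | (x, y - 1) \in C].
  have [Ea|Na] := eqVneq a x; have [Eb|Nb] := eqVneq b y.
  - by rewrite -Ea -Eb abC.
  - by rewrite -Ea (_ : y - 1 = b) ?abC ?orbT //; lia.
  - by rewrite -Eb (_ : x - 1 = a) ?abC ?orbT //; lia.
  - have -> : x - 1 = a by lia.
    have -> : y - 1 = b by lia.
    by rewrite abC !orbT.
case: ((x, y) \in C); case: ((x - 1, y) \in C); case: ((x - 1, y - 1) \in C);
  case: ((x, y - 1) \in C) => //= _ d1 d2 d3;
  by [case: (d3 isT isT isT isT) | have := d1 isT isT | have := d2 isT isT].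
Qed.

End Chain.

Section ChainDegrees.
Variables (G : graph point) (C : seq cell).
Hypotheses (PG : polyomino_system G) (CO : chain_order G C).
Local Notation c := (nth (0, 0) C).
Local Notation n := (size C).

Lemma degree_run v k m : (k + m.+1 <= n)%N ->
    (forall i, (i < n)%N -> touches C v i = (k <= i < k + m.+1)%N) ->
  degree G v = m.+2.
Proof.
move=> km tv; have tk : touches C v k by rewrite tv; lia.
rewrite (degree_count PG CO tk); congr _.+1.
rewrite -{1}(mkseq_nth (0, 0) C) count_map.
have -> : count (preim c (fun d => v \in corners d)) (iota 0 n) =
    count (fun i => (k <= i < k + m.+1)%N) (iota 0 n).
  apply: eq_in_count => i; rewrite mem_iota => /andP[_ ni] /=.
  by rewrite -tv /touches ?ni //; lia.
have -> : n = (k + (m.+1 + (n - (k + m.+1))))%N by lia.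
rewrite !iotaD !count_cat.
rewrite (eq_in_count (a2 := pred0)) => [|i]; last by rewrite mem_iota /=; lia.
rewrite [X in (_ + (X + _))%N](eq_in_count (a2 := predT)) => [|i]; last first.
  by rewrite mem_iota /=; lia.
rewrite [X in (_ + (_ + X))%N](eq_in_count (a2 := pred0)) => [|i]; last first.
  by rewrite mem_iota /=; lia.
by rewrite !count_pred0 count_predT size_iota addn0.
Qed.

(** Guarded because [0.-1] is [0]. *)
Definition touches_pred v k := (0 < k)%N && touches C v k.-1.

Lemma touches_lt v k : touches C v k -> (k < n)%N.
Proof. by case/andP. Qed.

Lemma degree_outer v k : touches C v k -> ~~ touches C v k.+1 ->
  ~~ touches_pred v k -> degree G v = 2%N.
Proof.
move=> tk tk1 tk0; have nk := touches_lt tk.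
apply: (@degree_run v k 0) => [|i ni]; first lia.
have [ti|nti] := boolP (touches C v i); last first.
  apply/esym/negbTE/negP => E; move: nti.
  have -> : i = k by lia.
  by rewrite tk.
have [ik|ki|->] := ltngtP i k; last by lia.
- have [E|[E ti1]] := touches_window PG CO ik ti tk.
    by move: tk0; rewrite /touches_pred E /= ti.
  by move: tk0; rewrite /touches_pred E /= ti1.
- have [E|[E ti1]] := touches_window PG CO ki tk ti; first by rewrite E (negPf tk1) in ti.
  by rewrite ti1 in tk1.
Qed.

Lemma touches_far_pred v k :
  touches_pred v k -> touches C v k.+2 -> false.
Proof. by case: k => // k /andP[_]; apply: (touches_far PG CO). Qed.

Lemma degree_inner v k : touches C v k -> touches C v k.+1 ->
  degree G v = (3 + touches C v k.+2 + touches_pred v k)%N.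
Proof.
move=> tk tk1; have nk := touches_lt tk1.
have far i j : (i.+2 < j)%N -> touches C v i -> touches C v j -> false.
  by move=> ij ti tj; case: (touches_window PG CO _ ti tj) => [||[]]; lia.
have [tk2|ntk2] := boolP (touches C v k.+2).
  have -> : touches_pred v k = false.
    by apply/negP => /touches_far_pred/(_ tk2).
  have nk2 := touches_lt tk2.
  apply: (@degree_run v k 2) => [|i ni]; first lia.
  have [ti|nti] := boolP (touches C v i); last first.
    apply/esym/negbTE/negP => E; move: nti.
    have [->|[->|->]] : i = k \/ i = k.+1 \/ i = k.+2 by lia.
    - by rewrite tk.
    - by rewrite tk1.
    - by rewrite tk2.
  have [ik|ki] := ltnP i k; first by have := far _ _ _ ti tk2; lia.
  by have [ki3|] := ltnP k.+2 i; [have := far _ _ _ tk ti|]; lia.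
have [/andP[k0 tk0]|ntk0] := boolP (touches_pred v k).
  apply: (@degree_run v k.-1 2) => [|i ni]; first lia.
  have [ti|nti] := boolP (touches C v i); last first.
    apply/esym/negbTE/negP => E; move: nti.
    have [->|[->|->]] : i = k.-1 \/ i = k \/ i = k.+1 by lia.
    - by rewrite tk0.
    - by rewrite tk.
    - by rewrite tk1.
  have [ik|ki] := ltnP i k.-1; first by have := far _ _ _ ti tk1; lia.
  by have [ki3|] := ltnP k.+1 i; [have := far _ _ _ tk0 ti|]; lia.
apply: (@degree_run v k 1) => [|i ni]; first lia.
have [ti|nti] := boolP (touches C v i); last first.
  apply/esym/negbTE/negP => E; move: nti.
  have [->|->] : i = k \/ i = k.+1 by lia.
  - by rewrite tk.
  - by rewrite tk1.
have [ik|ki] := ltnP i k.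
  have [E|N] := eqVneq i k.-1; last by have := far _ _ _ ti tk1; lia.
  by move: ntk0; rewrite /touches_pred -E ti; lia.
have [k1i|] := ltnP k.+1 i; last lia.
have [E|N] := eqVneq i k.+2; first by rewrite -E ti in ntk2.
by have := far _ _ _ tk ti; lia.
Qed.

Lemma consecutive_adjacent k : (k.+1 < n)%N -> adjacent (c k) (c k.+1).
Proof. by move=> nk; rewrite (chain_adjacent CO) ?eqxx //; lia. Qed.

Lemma middle_cells k : (k.+2 < n)%N ->
  [/\ adjacent (c k.+1) (c k), adjacent (c k.+1) (c k.+2) & c k != c k.+2].
Proof.
move=> nk; split.
- by rewrite adjacent_sym; apply: consecutive_adjacent; apply: ltnW.
- exact: consecutive_adjacent.
- rewrite nth_uniq ?(chain_uniq CO) //; first by rewrite -addn2; lia.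
  by do 2!apply: ltnW.
Qed.

(** The sides through which the chain enters and leaves a cell meet in one
    vertex at a bend and are disjoint otherwise. *)
Lemma bend_next p q k : p != q -> touches C p k -> touches C p k.+1 ->
    touches C q k -> touches C q k.+1 ->
  (touches C p k.+2 + touches C q k.+2)%N = bend C k.+1.
Proof.
move=> npq /andP[nk pk] /andP[nk1 pk1] /andP[_ qk] /andP[_ qk1].
rewrite /touches /bend /=; have [nk2|//] := ltnP k.+2 n.
have [a1 a2 a3] := middle_cells nk2.
have [p' [q' [o [s [[_ /perm_mem K] [pa qa oa sa] S]]]]] := quad_middle a1 a2 a3.
have ends v : v \in corners (c k) -> v \in corners (c k.+1) -> v = p' \/ v = q'.
  move=> vk; rewrite K !inE => /or4P[] /eqP E; rewrite E in vk *; [by left|by right| |].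
    by rewrite vk in oa.
  by rewrite vk in sa.
move: npq; case: (ends p) => // ->; case: (ends q) => // ->; rewrite ?eqxx // => _.
  by case: S => [-> /negPf-> _ _|/negPf-> /negPf-> _ _].
by case: S => [-> /negPf-> _ _|/negPf-> /negPf-> _ _].
Qed.

Lemma bend_pred p q k : p != q -> touches C p k -> touches C p k.+1 ->
    touches C q k -> touches C q k.+1 ->
  (touches_pred p k + touches_pred q k)%N = bend C k.
Proof.
move=> npq /andP[nk pk] /andP[nk1 pk1] /andP[_ qk] /andP[_ qk1].
rewrite /touches_pred /bend; case: k nk nk1 pk pk1 qk qk1 => //= k nk nk1 pk pk1 qk qk1.
rewrite /touches nk1 (ltnW nk) /=.
have [a1 a2 a3] := middle_cells nk1; rewrite eq_sym in a3.
have [p' [q' [o [s [[_ /perm_mem K] [pa qa oa sa] S]]]]] := quad_middle a2 a1 a3.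
have ends v : v \in corners (c k.+2) -> v \in corners (c k.+1) -> v = p' \/ v = q'.
  move=> vk; rewrite K !inE => /or4P[] /eqP E; rewrite E in vk *; [by left|by right| |].
    by rewrite vk in oa.
  by rewrite vk in sa.
have -> : turns (c k) (c k.+2) = turns (c k.+2) (c k).
  by rewrite /turns [_.1 == _]eq_sym [_.2 == _]eq_sym.
move: npq; case: (ends p) => // ->; case: (ends q) => // ->; rewrite ?eqxx // => _.
  by case: S => [-> /negPf-> _ _|/negPf-> /negPf-> _ _].
by case: S => [-> /negPf-> _ _|/negPf-> /negPf-> _ _].
Qed.

End ChainDegrees.

(** * Edge weights summed along a chain *)

Lemma big_fsetUI (T : choiceType) (V : zmodType) (A B : {fset T}) (F : T -> V) :
  \sum_(x <- A `|` B) F x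
    = \sum_(x <- A) F x + \sum_(x <- B) F x - \sum_(x <- A `&` B) F x.
Proof.
have ID (D : {fset T}) :
    \sum_(x <- D) F x = \sum_(x <- D `&` B) F x + \sum_(x <- D `\` B) F x.
  by rewrite (big_fsetID _ (mem B)); congr (_ + _); apply: eq_fbigl => x;
    rewrite !inE // andbC.
rewrite (ID (A `|` B)) (ID A) (fsetIidPr (fsubsetUr A B)) fsetDUl fsetDv fsetU0.
by rewrite [RHS]addrAC (addrC (\sum_(x <- A `&` B) _)) addrK addrC.
Qed.

Section CellSums.
Variables (G : graph point) (C : seq cell).
Hypotheses (PG : polyomino_system G) (CO : chain_order G C).
Variables (V : comNzRingType) (phi : nat -> nat -> V) (W : {fset point} -> V).
Hypothesis phiC : forall i j, phi i j = phi j i.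
Hypothesis W_edge :
  forall u v, u != v -> W [fset u; v] = phi (degree G u) (degree G v).
Local Notation c := (nth (0, 0) C).
Local Notation n := (size C).

(** The share, attributed to one neighbour, in the weight of the sides of a cell
    that are not shared: [t] tells whether the cell bends and [s] whether that
    neighbour does.  The unshared sides at a bend end in its outer corner, of
    degree two.  The two sides of a terminal cell that lead away from its
    neighbour also end in corners of degree two; one of them has the weight
    [flank s true]. *)
Definition flank (s t : bool) : V := phi (3 - t) (3 + s).

(** Each of the two cells at a shared side, if it bends, raises the degree of
    one end of that side. *)
Definition rung (s t : bool) : V := phi (3 + s) (3 + t).

(** For a straight cell between two bends this says that the bends turn to
    opposite sides: otherwise its outer long side joins two vertices of degree
    three. *)
Definition no_U_turn k := bend C k -> ~~ bend C k.+1 -> bend C k.+2 ->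
  forall u v, edge (sides (c k.+1)) u v ->
    ~ (degree G u = 3%N /\ degree G v = 3%N).

Lemma quad_sum m p q o s : quad m p q o s ->
  \sum_(e <- sides m) W e = W [fset p; q] + W [fset q; o] + W [fset o; s] + W [fset s; p].
Proof.
by case=> S _; rewrite (perm_big _ S) /= !big_cons big_nil addr0 !addrA.
Qed.

Lemma quad_uniq m p q o s : quad m p q o s -> uniq [:: p; q; o; s].
Proof. by case=> _ /perm_uniq <-; apply: fset_uniq. Qed.

(** Bends on both sides of a shared side raise the degrees of different ends,
    since a common one would belong to four consecutive cells. *)
Lemma rung_shared k p q : (k.+1 < n)%N -> p != q ->
    touches C p k -> touches C p k.+1 -> touches C q k -> touches C q k.+1 ->
  W [fset p; q] = rung (bend C k) (bend C k.+1).
Proof.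
move=> nk npq p0 p1 q0 q1; rewrite W_edge // (degree_inner PG CO p0 p1) (degree_inner PG CO q0 q1) /rung.
have := bend_next CO npq p0 p1 q0 q1; have := bend_pred CO npq p0 p1 q0 q1.
have := touches_far_pred PG CO (v := p) (k := k).
have := touches_far_pred PG CO (v := q) (k := k).
case: (touches_pred _ p k); case: (touches_pred _ q k);
  case: (touches C p k.+2); case: (touches C q k.+2);
  case: (bend C k); case: (bend C k.+1) => //= fq fp _ _;
  [by have := fp isT isT | by have := fq isT isT].
Qed.

Lemma sum_rung k : (k.+1 < n)%N ->
  \sum_(e <- sides (c k) `&` sides (c k.+1)) W e = rung (bend C k) (bend C k.+1).
Proof.
move=> nk; have adj := consecutive_adjacent CO nk.
have [p [q [o [s [Q [pb qb ob sb]]]]]] := quad_end adj.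
have [e E] := adjacent_sides adj.
have := fset11 e; rewrite -E in_fsetI => /andP[e0 e1].
rewrite E big_seq_fset1 (quad_shared Q ob sb e1 e0).
have K v : v \in [:: p; q; o; s] -> v \in corners (c k).
  by case: Q => _ /perm_mem ->.
apply: rung_shared; rewrite // /touches ?nk ?(ltnW nk) ?K ?inE ?eqxx ?orbT //.
by have /= := quad_uniq Q; rewrite !inE !negb_or => /andP[/and3P[]].
Qed.

Lemma quad_touches m p q o s k : quad m p q o s -> (k < n)%N -> m = c k ->
  [/\ touches C p k, touches C q k, touches C o k & touches C s k].
Proof.
move=> [_ /perm_mem K] nk E.
by split; rewrite /touches nk -E K !inE eqxx ?orbT.
Qed.

Lemma quad_neq m p q o s : quad m p q o s ->
  [/\ p != q, q != o, o != s & s != p].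
Proof.
move/quad_uniq; rewrite /= !inE !negb_or => /and4P[/and3P[pq po ps] /andP[qo qs] os _].
by rewrite [s == p]eq_sym.
Qed.

Lemma sum_first : (1 < n)%N ->
  \sum_(e <- sides (c 0)) W e
    = phi 2 2 + phi 2 3 + flank (bend C 1) true + rung false (bend C 1).
Proof.
move=> n1; have [p [q [o [s [Q [pb qb ob sb]]]]]] := quad_end (consecutive_adjacent CO n1).
have [npq nqo nos nsp] := quad_neq Q.
have [p0 q0 o0 s0] := quad_touches Q (ltnW n1) erefl.
have p1 : touches C p 1 by rewrite /touches n1.
have q1 : touches C q 1 by rewrite /touches n1.
have no1 : ~~ touches C o 1 by rewrite /touches n1.
have ns1 : ~~ touches C s 1 by rewrite /touches n1.
rewrite (quad_sum Q) (rung_shared n1 npq p0 p1 q0 q1) !W_edge //.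
rewrite (degree_outer PG CO o0 no1) // (degree_outer PG CO s0 ns1) //.
rewrite (degree_inner PG CO p0 p1) (degree_inner PG CO q0 q1) /touches_pred /= !addn0.
have := bend_next CO npq p0 p1 q0 q1; rewrite /flank [phi (3 + _) 2]phiC.
by case: (touches C p 2); case: (touches C q 2); case: (bend C 1) => //= _;
  rewrite ?addn0 ?addn1; ring.
Qed.

Lemma sum_last : (1 < n)%N ->
  \sum_(e <- sides (c n.-1)) W e
    = phi 2 2 + phi 2 3 + flank (bend C n.-2) true + rung (bend C n.-2) false.
Proof.
case En : n => [|[|k]] // _; have n1 : (k.+1 < n)%N by rewrite En.
have := consecutive_adjacent CO n1; rewrite adjacent_sym => /quad_end.
case=> p [q [o [s [Q [pb qb ob sb]]]]].
have [npq nqo nos nsp] := quad_neq Q.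
have [p1 q1 o1 s1] := quad_touches Q n1 erefl.
have n0 : (k < n)%N by apply: ltnW.
have p0 : touches C p k by rewrite /touches n0.
have q0 : touches C q k by rewrite /touches n0.
have no0 : ~~ touches_pred C o k.+1 by rewrite /touches_pred /touches n0.
have ns0 : ~~ touches_pred C s k.+1 by rewrite /touches_pred /touches n0.
have no2 v : touches C v k.+2 = false by rewrite /touches En ltnn.
have bl : bend C k.+1 = false by rewrite /bend En ltnn andbF.
rewrite (quad_sum Q) (rung_shared n1 npq p0 p1 q0 q1) !W_edge // bl.
rewrite (degree_outer PG CO o1) ?no2 // (degree_outer PG CO s1) ?no2 //.
rewrite (degree_inner PG CO p0 p1) (degree_inner PG CO q0 q1) !no2 !addn0.
have := bend_pred CO npq p0 p1 q0 q1; rewrite /flank [phi (3 + _) 2]phiC.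
by case: (touches_pred C p k); case: (touches_pred C q k); case: (bend C k) => //= _;
  rewrite ?addn0 ?addn1; ring.
Qed.

(** In a straight cell between two bends each long side has exactly one end of
    degree four, because of [no_U_turn]; this makes the weight of its long
    sides the sum of the shares of both neighbours. *)
Lemma sum_middle k : (k.+2 < n)%N -> no_U_turn k ->
  \sum_(e <- sides (c k.+1)) W e
    = rung (bend C k) (bend C k.+1) + rung (bend C k.+1) (bend C k.+2)
      + flank (bend C k) (bend C k.+1) + flank (bend C k.+2) (bend C k.+1).
Proof.
move=> nk noU; have [a1 a2 a3] := middle_cells CO nk.
have nk1 : (k.+1 < n)%N by apply: ltnW.
have nk0 : (k < n)%N by apply: ltnW.
have [p [q [o [s [Q [pa qa oa sa] S]]]]] := quad_middle a1 a2 a3.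
have [npq nqo nos nsp] := quad_neq Q.
have [p1 q1 o1 s1] := quad_touches Q nk1 erefl.
have p0 : touches C p k by rewrite /touches nk0.
have q0 : touches C q k by rewrite /touches nk0.
have no0 : ~~ touches C o k by rewrite /touches nk0.
have ns0 : ~~ touches C s k by rewrite /touches nk0.
have Eb : turns (c k) (c k.+2) = bend C k.+1 by rewrite /bend nk.
have Ep := bend_pred CO npq p0 p1 q0 q1.
have Pp := touches_far_pred PG CO (v := p) (k := k).
have Pq := touches_far_pred PG CO (v := q) (k := k).
have Fo := touches_far PG CO (v := p) (k := k).
rewrite Eb in S; move: noU; rewrite /no_U_turn.
case Bk : (bend C k.+1) / S => [pb qb ob sb|pb qb ob sb] noU.
  have p2 : touches C p k.+2 by rewrite /touches nk.
  have s2 : touches C s k.+2 by rewrite /touches nk.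
  have nq2 : ~~ touches C q k.+2 by rewrite /touches nk.
  have no2 : ~~ touches C o k.+2 by rewrite /touches nk.
  have nps : p != s by rewrite eq_sym.
  have En := bend_next CO nps p1 p2 s1 s2.
  rewrite (quad_sum Q) (rung_shared nk1 npq p0 p1 q0 q1).
  rewrite (rung_shared nk _ s1 s2 p1 p2) // !W_edge //.
  rewrite (degree_outer PG CO o1) // (degree_inner PG CO q0 q1).
  rewrite (degree_inner PG CO s1 s2) /touches_pred /= (negPf ns0) (negPf nq2) !addn0.
  have Tp : touches_pred C p k = false by apply/negP => /Pp/(_ p2).
  have Tp3 : touches C p k.+3 = false by apply/negP => /(Fo p0).
  move: En Ep; rewrite Tp Tp3 !add0n Bk /flank /= => -> ->; rewrite [phi (3 + _) 2]phiC.
  ring.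
have o2 : touches C o k.+2 by rewrite /touches nk.
have s2 : touches C s k.+2 by rewrite /touches nk.
have np2 : touches C p k.+2 = false by rewrite /touches (negPf pb) andbF.
have nq2 : touches C q k.+2 = false by rewrite /touches (negPf qb) andbF.
have En := bend_next CO nos o1 o2 s1 s2.
have dp := degree_inner PG CO p0 p1; have dq := degree_inner PG CO q0 q1.
have ds := degree_inner PG CO s1 s2; have d_o := degree_inner PG CO o1 o2.
rewrite np2 nq2 /touches_pred /= (negPf no0) (negPf ns0) !addn0 in dp dq ds d_o.
have [qo sp] : edge (sides (c k.+1)) q o /\ edge (sides (c k.+1)) s p.
  by case: Q => /perm_mem E _; rewrite /edge !E !inE !eqxx !orbT.
rewrite (quad_sum Q) (rung_shared nk1 npq p0 p1 q0 q1).
rewrite (rung_shared nk nos o1 o2 s1 s2) Bk !W_edge //.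
have N1 Bp Bn := noU Bp isT Bn q o qo; have N2 Bp Bn := noU Bp isT Bn s p sp.
move: {noU} N1 N2 En Ep; rewrite dp dq ds d_o /flank -!/(touches_pred C _ k).
case: (touches_pred C p k); case: (touches_pred C q k); case: (touches C o k.+3);
  case: (touches C s k.+3); case: (bend C k); case: (bend C k.+2) => //= N1 N2 _ _;
  rewrite ?addn0 ?addn1 ?[phi 4 3]phiC; first [ring | by case: N1 | by case: N2].
Qed.

Lemma in_graph_of_cells s e :
  (e \in graph_of_cells s) = has (fun d => e \in sides d) s.
Proof.
apply/bigfcupP/hasP => [[d]|[d ds ed]]; first by rewrite andbT; exists d.
by exists d; rewrite ?andbT.
Qed.

(** A new cell meets the union of the preceding ones in the side that it shares
    with the last of them. *)
Lemma sum_prefix k : (k <= n)%N ->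
  \sum_(e <- graph_of_cells (take k C)) W e
    + \sum_(j < k.-1) rung (bend C j) (bend C j.+1)
  = \sum_(j < k) \sum_(e <- sides (c j)) W e.
Proof.
elim: k => [_|k IH nk].
  by rewrite take0 !big_ord0 addr0 [graph_of_cells _]big_nil big_seq_fset0.
rewrite [RHS]big_ord_recr /= -IH; last exact: ltnW.
have -> : graph_of_cells (take k.+1 C) = graph_of_cells (take k C) `|` sides (c k).
  rewrite (take_nth (0, 0) nk); apply/fsetP => e.
  by rewrite in_fsetU !in_graph_of_cells has_rcons orbC.
rewrite big_fsetUI; case: k nk {IH} => [|k] nk.
  rewrite take0 [graph_of_cells _]big_nil fset0I !big_seq_fset0 !big_ord0.
  by rewrite subr0 !addr0.
have -> : graph_of_cells (take k.+1 C) `&` sides (c k.+1)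
    = sides (c k) `&` sides (c k.+1).
  apply/fsetP => e; rewrite !in_fsetI in_graph_of_cells.
  have [e1|] := boolP (e \in sides (c k.+1)); last by rewrite !andbF.
  rewrite !andbT; apply/hasP/idP => [[d /(nthP (0, 0))[i]]|ek]; last first.
    exists (c k) => //; rewrite -(nth_take (0, 0) (ltnSn k)).
    by rewrite mem_nth // size_take nk.
  rewrite size_take nk => ik; rewrite nth_take // => <- ei.
  have [->//|nik] := eqVneq k i; have ni : (i < n)%N by lia.
  have : adjacent (c i) (c k.+1).
    rewrite /adjacent nth_uniq ?(chain_uniq CO) //.
    by rewrite (_ : i != k.+1) /=; [apply/fset0Pn; exists e; rewrite in_fsetI ei | lia].
  by rewrite (chain_adjacent CO) //; lia.
rewrite sum_rung //= big_ord_recr /=; ring.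
Qed.

Lemma sum_graph : \sum_(e <- G) W e + \sum_(k < n.-1) rung (bend C k) (bend C k.+1)
  = \sum_(k < n) \sum_(e <- sides (c k)) W e.
Proof.
rewrite -sum_prefix // take_size; congr (_ + _); congr (\sum_(e <- enum_fset _) _).
by apply/fsetP => e; rewrite in_graph_of_cells (chain_edge PG CO).
Qed.

Definition end_bond (t : bool) : V := rung false t + flank false t + flank t true.
Definition bond (s t : bool) : V := rung s t + flank s t + flank t s.

(** The weight of a shared side and the shares that its two cells attribute to
    each other depend on the two indicators only, which leaves a sum over the
    pairs of consecutive cells. *)
Lemma chain_sum m : n = m.+3 -> (forall k, (k.+2 < n)%N -> no_U_turn k) ->
  \sum_(e <- G) W e = (phi 2 2 + phi 2 3) *+ 2
    + end_bond (bend C 1) + end_bond (bend C m.+1)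
    + \sum_(j < m) bond (bend C j.+1) (bend C j.+2).
Proof.
move=> En noU; have b0 : bend C 0 = false by [].
have bn : bend C m.+2 = false by rewrite /bend En ltnn andbF.
have recl (F : nat -> V) k : \sum_(j < k.+1) F j = F 0 + \sum_(j < k) F j.+1.
  by rewrite big_ord_recl; congr (_ + _); apply: eq_bigr => j _; rewrite lift0.
have Sr := recl (fun k => rung (bend C k) (bend C k.+1)).
have S1 := recl (fun k => flank (bend C k) (bend C k.+1)).
have inner : \sum_(k < m.+1) \sum_(e <- sides (c k.+1)) W e
  = (rung false (bend C 1) + \sum_(j < m) rung (bend C j.+1) (bend C j.+2))
    + (\sum_(j < m) rung (bend C j.+1) (bend C j.+2) + rung (bend C m.+1) false)
    + (flank false (bend C 1) + \sum_(j < m) flank (bend C j.+1) (bend C j.+2))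
    + (\sum_(j < m) flank (bend C j.+2) (bend C j.+1)
       + flank false (bend C m.+1)).
  transitivity (\sum_(k < m.+1) (rung (bend C k) (bend C k.+1)
      + rung (bend C k.+1) (bend C k.+2) + flank (bend C k) (bend C k.+1)
      + flank (bend C k.+2) (bend C k.+1))).
    apply: eq_bigr => i _.
    have ni : (i.+2 < n)%N by rewrite En !ltnS -ltnS.
    by rewrite (sum_middle ni) //; apply: noU.
  rewrite !big_split /= Sr S1 b0; congr (_ + _ + _ + _);
    by rewrite big_ord_recr /= bn.
have := sum_graph; have := sum_first; have := sum_last; rewrite En /= => Sl Sf.
rewrite (recl (fun k => \sum_(e <- sides (c k)) W e)) [in RHS]big_ord_recr /=.
rewrite Sl // Sf // inner Sr big_ord_recr b0 bn /=.
rewrite /end_bond /bond !big_split /= mulr2n => E.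
apply: (addIr _ (etrans E _)).
rewrite -[bend C 0.+1]/(bend C 1) (_ : rung (bend C m.+1) false = rung false (bend C m.+1)).
  ring.
by rewrite /rung phiC.
Qed.

End CellSums.

(** * Bends and kinks *)

Section Kinks.
Variables (G : graph point) (C : seq cell).
Hypotheses (PG : polyomino_system G) (CO : chain_order G C).
Local Notation c := (nth (0, 0) C).
Local Notation n := (size C).

Lemma square_nth k : (k < n)%N -> square G (c k).
Proof. by move=> nk; apply/(chain_square CO)/mem_nth. Qed.

Lemma nonterminal_index d : nonterminal G d ->
  exists2 k, (k.+2 < n)%N & d = c k.+1.
Proof.
case=> /(chain_square CO)/(nthP (0, 0))[k nk <-] [d1 [d2 [n12 [+ a1] [+ a2]]]].
move=> /(chain_square CO)/(nthP (0, 0))[i ni Ei] /(chain_square CO)/(nthP (0, 0))[j nj Ej].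
move: a1 a2; rewrite -Ei -Ej !(chain_adjacent CO) // => ki kj.
have nij : i <> j by move=> E; apply: n12; rewrite -Ei -Ej E.
case: k nk ki kj => [|k] nk ki kj; first lia.
exists k => //; have [E|E] : i = k.+2 \/ j = k.+2 by lia.
  by rewrite -E.
by rewrite -E.
Qed.

(** At a bend the corner away from both neighbours belongs to no other cell;
    in a straight cell each corner is shared. *)
Lemma bend_outer k : bend C k.+1 ->
  exists2 v, v \in corners (c k.+1) & degree G v = 2%N.
Proof.
case/and3P=> _ nk tk; have [a1 a2 a3] := middle_cells CO nk.
have [p [q [o [s [Q [pa qa oa sa] S]]]]] := quad_middle a1 a2 a3.
have nk1 : (k.+1 < n)%N by apply: ltnW.
have [p1 q1 o1 s1] := quad_touches Q nk1 erefl.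
exists o; first by case/andP: o1.
rewrite tk in S; inversion S.
apply: (degree_outer PG CO o1); first by rewrite /touches negb_and orbC H1.
by rewrite /touches_pred /touches !negb_and orbC orbC /= oa orbT.
Qed.

Lemma straight_degree k v : (k.+2 < n)%N -> ~~ bend C k.+1 ->
  v \in corners (c k.+1) -> degree G v <> 2%N.
Proof.
move=> nk; rewrite /bend nk /= => /negbTE tk vk.
have [a1 a2 a3] := middle_cells CO nk.
have [p [q [o [s [[_ /perm_mem K] [pa qa oa sa] S]]]]] := quad_middle a1 a2 a3.
rewrite tk in S; inversion S.
have nk1 := ltnW nk; have nk0 := ltnW nk1.
have t1 : touches C v k.+1 by rewrite /touches nk1.
have [t|t] : touches C v k \/ touches C v k.+2.
- rewrite /touches nk nk0 /=; move: vk; rewrite K !inE.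
  by case/or4P=> /eqP->; auto.
- by rewrite (degree_inner PG CO t t1).
- by rewrite (degree_inner PG CO t1 t).
Qed.

Lemma kinkP d : kink G d <-> exists2 k, bend C k.+1 & d = c k.+1.
Proof.
split.
  case=> /nonterminal_index[k nk ->] [v [vk dv]]; exists k => //.
  by apply/negPn/negP => /(straight_degree nk)/(_ vk).
case=> k bk ->; have nk : (k.+2 < n)%N by case/and3P: bk.
have [a1 a2 /eqP a3] := middle_cells CO nk.
split; last by have [v vk dv] := bend_outer bk; exists v.
split; first by apply: square_nth; lia.
exists (c k), (c k.+2); split=> //; split=> //; apply: square_nth; lia.
Qed.

Lemma no_kink_bend k : (forall d, ~ kink G d) -> bend C k = false.
Proof.
move=> nok; case: k => // k; apply/negP => bk.
by apply: (nok (c k.+1)); apply/kinkP; exists k.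
Qed.

Lemma all_kinks_bend k : (forall d, square G d -> kink G d \/ terminal G d) ->
  (k.+2 < n)%N -> bend C k.+1.
Proof.
move=> all nk; have nk1 : (k.+1 < n)%N by apply: ltnW.
have [/kinkP[j bj /eqP]|[_ [d [_ ud]]]] := all _ (square_nth nk1).
  rewrite nth_uniq ?(chain_uniq CO) //; first by move/eqP=> [->].
  by case/and3P: bj => _ /ltnW.
have [a1 a2 /eqP[]] := middle_cells CO nk.
have sq i : (i < n)%N -> adjacent (c k.+1) (c i) -> d = c i.
  by move=> ni ai; apply: ud; split=> //; apply: square_nth.
by rewrite -(sq k) ?(sq k.+2) //; apply: ltnW.
Qed.

End Kinks.

(** * Straight polyomino chains of two and three squares *)

Section Reach.
Variables (G : graph point) (A : {fset point}).

Definition reach (u v : point) : Prop :=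
  exists p, [/\ path (edge G) u p, last u p = v & {subset p <= A}].

Lemma reach_refl u : reach u u. Proof. by exists [::]. Qed.

Lemma reach_step u v w : edge G u v -> v \in A -> reach v w -> reach u w.
Proof.
move=> uv vA [p [vp lp pA]]; exists (v :: p); rewrite /= uv; split=> // x.
by rewrite inE => /orP[/eqP->|/pA].
Qed.

Lemma reach_trans u v w : reach u v -> reach v w -> reach u w.
Proof.
move=> [p [up lp pA]] [q [vq lq qA]]; exists (p ++ q).
rewrite cat_path last_cat lp up; split=> // x.
by rewrite mem_cat => /orP[/pA|/qA].
Qed.

Lemma reach_sym u v : u \in A -> reach u v -> reach v u.
Proof.
move=> uA [p [up <- pA]]; elim: p u uA up pA => [|w p IH] u uA /=.
  by move=> _ _; apply: reach_refl.
case/andP=> uw wp pA; have wA : w \in A by apply: pA; apply: mem_head.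
apply: reach_trans (IH w wA wp _) _.
  by move=> x xp; apply: pA; rewrite inE xp orbT.
by apply: (@reach_step w u u); rewrite 1?edge_sym //; apply: reach_refl.
Qed.

Lemma connected_root r :
  r \in A -> (forall u, u \in A -> reach r u) -> connected_on G A.
Proof.
move=> rA R u v uA vA; apply: reach_trans (R v vA).
exact: reach_sym (R u uA).
Qed.

End Reach.

Lemma reach_sub G H A B u v :
  G `<=` H -> A `<=` B -> reach G A u v -> reach H B u v.
Proof.
move=> /fsubsetP GH /fsubsetP AB [p [up lp pA]]; exists p; split=> //.
- by apply: sub_path up => a b; apply: GH.
- by move=> x /pA/AB.
Qed.

Lemma connected_onU (G H : graph point) (A B : {fset point}) r :
  connected_on G A -> connected_on H B ->
  r \in A -> r \in B -> connected_on (G `|` H) (A `|` B).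
Proof.
move=> cG cH rA rB; apply: (@connected_root _ _ r); first by rewrite in_fsetU rA.
move=> u; rewrite in_fsetU => /orP[uA|uB].
  by apply: reach_sub (cG _ _ rA uA); rewrite fsubsetUl.
by apply: reach_sub (cH _ _ rB uB); rewrite fsubsetUr.
Qed.

Lemma two_connected_minus (G : graph point) x :
  two_connected G -> connected_on G (vertices G `\ x).
Proof.
case=> _ c0 c1; have [/c1//|xG] := boolP (x \in vertices G).
suff -> : vertices G `\ x = vertices G by [].
apply/fsetP => y; rewrite in_fsetD1; have [->|//] := eqVneq y x.
by rewrite (negPf xG).
Qed.

Lemma verticesU (G H : graph point) :
  vertices (G `|` H) = vertices G `|` vertices H.
Proof.
apply/fsetP => v; rewrite in_fsetU; apply/bigfcupP/orP.
  case=> e; rewrite andbT in_fsetU => /orP[eG|eH] ve; [left|right];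
    by apply/bigfcupP; exists e; rewrite ?andbT.
by case=> /bigfcupP[e]; rewrite andbT => eG ve; exists e;
  rewrite ?andbT ?in_fsetU ?eG ?orbT.
Qed.

(** Removing one vertex leaves a common one. *)
Lemma two_connectedU (G H : graph point) p q :
    two_connected G -> two_connected H -> p != q ->
    p \in vertices G -> p \in vertices H -> q \in vertices G ->
    q \in vertices H -> two_connected (G `|` H).
Proof.
move=> G2 H2 npq pG pH qG qH; case: (G2) => cardG cG _; case: (H2) => _ cH _.
rewrite /two_connected verticesU; split.
- by apply: leq_trans cardG _; rewrite fsubset_leq_card // fsubsetUl.
- exact: connected_onU pG pH.
move=> x _; rewrite fsetDUl.
have cGx := two_connected_minus (x := x) G2.
have cHx := two_connected_minus (x := x) H2.
have [E|N] := eqVneq p x.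
  by apply: (connected_onU cGx cHx (r := q)); rewrite in_fsetD1 -E eq_sym npq.
by apply: (connected_onU cGx cHx (r := p)); rewrite in_fsetD1 N.
Qed.

Lemma quad_connected m p q o s : quad m p q o s ->
  connected_on (sides m) (corners m) /\ connected_on (sides m) (corners m `\ s).
Proof.
move=> Q; have [npq nqo nos nsp] := quad_neq Q.
have := quad_uniq Q; rewrite /= !inE !negb_or.
case/and4P=> /and3P[_ npo nps] /andP[_ nqs] _ _.
case: Q => /perm_mem S /perm_mem K.
have e1 : edge (sides m) p q by rewrite /edge S !inE eqxx.
have e2 : edge (sides m) q o by rewrite /edge S !inE eqxx !orbT.
have e3 : edge (sides m) o s by rewrite /edge S !inE eqxx !orbT.
have cor v : v \in corners m -> [\/ v = p, v = q, v = o | v = s].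
  by rewrite K !inE => /or4P[] /eqP; [constructor 1|constructor 2|constructor 3|constructor 4].
have [pK qK oK sK] : [/\ p \in corners m, q \in corners m, o \in corners m & s \in corners m].
  by rewrite !K !inE !eqxx !orbT.
split; apply: (connected_root (r := p)) => //.
- move=> u /cor[->|->|->|->]; first exact: reach_refl.
  + exact: reach_step e1 _ (reach_refl _ _ _).
  + by apply: reach_step e1 _ _ => //; apply: reach_step e2 _ (reach_refl _ _ _).
  + apply: reach_step e1 _ _ => //; apply: reach_step e2 _ _ => //.
    exact: reach_step e3 _ (reach_refl _ _ _).
- by rewrite in_fsetD1 nps.
- move=> u; rewrite in_fsetD1 => /andP[nus /cor[->|->|->|E]].
  + exact: reach_refl.
  + by apply: reach_step e1 _ (reach_refl _ _ _); rewrite in_fsetD1 nqs.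
  + apply: reach_step e1 _ _; first by rewrite in_fsetD1 nqs.
    by apply: reach_step e2 _ (reach_refl _ _ _); rewrite in_fsetD1 nos.
  + by rewrite E eqxx in nus.
Qed.

Lemma two_connected_sides c : two_connected (sides c).
Proof.
case: c => x y; have Q := quad_cell x y; split.
- by case: Q => _ /perm_size; rewrite /corners => ->.
- by case: (quad_connected Q).
move=> v; case: (Q) => _ /perm_mem K; rewrite -/(corners (x, y)) K !inE.
case/or4P=> /eqP->.
- by case: (quad_connected (quad_rot Q)).
- by case: (quad_connected (quad_rot (quad_rot Q))).
- by case: (quad_connected (quad_rot (quad_rot (quad_rot Q)))).
- by case: (quad_connected Q).
Qed.

Lemma third_cell e a b d : e \in sides a -> e \in sides b -> e \in sides d ->
  a != b -> d = a \/ d = b.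
Proof.
move=> ea; have [[x [y E]]|[x [y E]]] := sides_edge ea; rewrite E in ea *;
  move: ea; rewrite ?hedge_sides ?vedge_sides => /orP[] /eqP->;
  move=> /orP[] /eqP-> /orP[] /eqP->; rewrite ?eqxx //; by [left|right].
Qed.

(** A ray of cells outside [s] crosses no edge of [graph_of_cells s]. *)
Lemma ray_exterior s (d : cell) (dx dy : int) :
    `|dx| + `|dy| = 1 ->
    (forall k : nat, (d.1 + k%:Z * dx, d.2 + k%:Z * dy) \notin s) ->
  ~ in_interior_face (graph_of_cells s) d.
Proof.
move=> unit ray [N bound]; pose cell_at k : cell := (d.1 + k%:Z * dx, d.2 + k%:Z * dy).
have face k : same_face (graph_of_cells s) d (cell_at k).
  elim: k => [|k [p [dp lp]]].
    by exists [::]; split=> //; rewrite /cell_at !mul0r !addr0; case: (d).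
  exists (rcons p (cell_at k.+1)); rewrite rcons_path dp last_rcons lp; split=> //=.
  have : adjacent (cell_at k) (cell_at k.+1).
    by rewrite adjacentE /= -addn1 PoszD; lia.
  case/andP=> neq /fset0Pn[e]; rewrite in_fsetI => /andP[e1 e2].
  apply/fsubsetPn; exists e; first by rewrite in_fsetI e1.
  rewrite in_graph_of_cells; apply/hasP => -[f fs ef].
  by case: (third_cell e1 e2 ef neq) fs => ->; apply/negP; apply: ray.
have [] := bound _ (face (`|N| + `|d.1| + `|d.2| + 1)%N).
rewrite /=; case: d {ray bound cell_at face} => a b /=.
have [[-> ->]|[[-> ->]|[[-> ->]|[-> ->]]]] : dx = 1 /\ dy = 0 \/
  dx = - 1 /\ dy = 0 \/ dx = 0 /\ dy = 1 \/ dx = 0 /\ dy = - 1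
  by move: unit; lia.
all: by lia.
Qed.

Definition in_row (s : seq cell) : Prop :=
  exists x1 x2 y, forall d : cell, d \in s <-> d.2 = y /\ x1 <= d.1 <= x2.

Definition in_column (s : seq cell) : Prop :=
  exists y1 y2 x, forall d : cell, d \in s <-> d.1 = x /\ y1 <= d.2 <= y2.

(** A cell off the line escapes perpendicularly to it, a cell on the line along
    it. *)
Lemma row_exterior s d :
  in_row s \/ in_column s -> d \notin s -> ~ in_interior_face (graph_of_cells s) d.
Proof.
move=> L /negP ds.
have out dx dy : `|dx| + `|dy| = 1 :> int ->
    (forall k : nat, ~ (d.1 + k%:Z * dx, d.2 + k%:Z * dy) \in s) ->
    ~ in_interior_face (graph_of_cells s) d.
  by move=> unit ray; apply: (ray_exterior unit) => k; apply/negP/ray.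
case: L => [[x1 [x2 [y H]]]|[y1 [y2 [x H]]]]; move: out ds; case: d => a b /= out /H /= ds.
- have [E|E] : b = y \/ b <> y by lia.
    have [X|X] : a < x1 \/ x2 < a by lia.
      by apply: (out (-1) 0) => // k /H /=; lia.
    by apply: (out 1 0) => // k /H /=; lia.
  have [Y|Y] : b < y \/ y < b by lia.
    by apply: (out 0 (-1)) => // k /H /=; lia.
  by apply: (out 0 1) => // k /H /=; lia.
- have [E|E] : a = x \/ a <> x by lia.
    have [X|X] : b < y1 \/ y2 < b by lia.
      by apply: (out 0 (-1)) => // k /H /=; lia.
    by apply: (out 0 1) => // k /H /=; lia.
  have [Y|Y] : a < x \/ x < a by lia.
    by apply: (out (-1) 0) => // k /H /=; lia.
  by apply: (out 1 0) => // k /H /=; lia.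
Qed.

Lemma sides_sub_graph s d : d \in s -> sides d `<=` graph_of_cells s.
Proof.
move=> ds; apply/fsubsetP => e ed; rewrite in_graph_of_cells.
by apply/hasP; exists d.
Qed.

Section StraightChain.
Variable s : seq cell.
Hypotheses (us : uniq s) (size_s : (size s <= 3)%N) (line : in_row s \/ in_column s).
Hypothesis two_s : two_connected (graph_of_cells s).
Hypothesis adj_s : forall i j, (i < size s)%N -> (j < size s)%N ->
  adjacent (nth (0, 0) s i) (nth (0, 0) s j) = (j == i.+1) || (i == j.+1).

Lemma straight_square d : square (graph_of_cells s) d <-> d \in s.
Proof.
split=> [sd|ds]; last exact/sides_square/sides_sub_graph.
by apply/negPn/negP => ds; apply: (row_exterior line ds).
Qed.

Lemma straight_order : chain_order (graph_of_cells s) s.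
Proof.
split=> [//|d|i j ni nj]; first by split=> /straight_square.
rewrite adj_s //; split=> [/orP[] /eqP|]; [by left|by right|].
by case=> ->; rewrite eqxx ?orbT.
Qed.

Lemma straight_system : polyomino_system (graph_of_cells s).
Proof.
split=> // [e|d /straight_square ds d' [[|f p] [/=]]].
- by rewrite in_graph_of_cells => /hasP[d _ ed]; exists d.
- by move=> _.
- rewrite /open_step; case/andP=> /negP[].
  exact: fsubset_trans (fsubsetIl _ _) (sides_sub_graph ds).
Qed.

Lemma straight_chain : polyomino_chain (size s) (graph_of_cells s).
Proof.
split; first exact: straight_system; last by exists s; split=> //; apply: straight_order.
move=> d /straight_square ds t ut td.
suff : (size (d :: t) <= size s)%N by move=> /= H; apply: leq_trans H size_s.
apply: uniq_leq_size => [|f] /=.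
  by rewrite ut andbT; apply/negP => /td[_ /andP[]]; rewrite eqxx.
by rewrite inE => /orP[/eqP->//|/td[/straight_square]].
Qed.

(** These chains serve to exhibit segments: a straight triple between two bends
    is one, and the pairs beyond the bends lie in other ones. *)
Lemma straight_linear : bend s 1 = false -> linear_chain (size s) (graph_of_cells s).
Proof.
move=> b1; split=> [|d]; first exact: straight_chain.
move/(kinkP straight_system straight_order) => [[|k] bk _].
  by rewrite b1 in bk.
by case/and3P: bk => _ nk _; have := leq_trans nk size_s.
Qed.

End StraightChain.

Lemma two_connected_cons a s : s != [::] -> adjacent a (head (0, 0) s) ->
  two_connected (graph_of_cells s) -> two_connected (graph_of_cells (a :: s)).
Proof.
case: s => // b s _ /= ab s2.
have -> : graph_of_cells [:: a, b & s] = sides a `|` graph_of_cells (b :: s).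
  by apply/fsetP => e; rewrite in_fsetU !in_graph_of_cells.
have [p [q [o [t [Q [pb qb _ _]]]]]] := quad_end ab.
have [npq _ _ _] := quad_neq Q; have [_ /perm_mem K] := Q.
have sub v : v \in corners b -> v \in vertices (graph_of_cells (b :: s)).
  case/bigfcupP => e; rewrite andbT => eb ve; apply/bigfcupP; exists e => //.
  by rewrite andbT in_graph_of_cells /= eb.
apply: (two_connectedU (two_connected_sides a) s2 npq) => //; try exact: sub.
- by rewrite -/(corners a) K !inE eqxx.
- by rewrite -/(corners a) K !inE eqxx orbT.
Qed.

Lemma two_connected_seq1 a : two_connected (graph_of_cells [:: a]).
Proof.
have -> : graph_of_cells [:: a] = sides a; last exact: two_connected_sides.
by apply/fsetP => e; rewrite in_graph_of_cells /= orbF.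
Qed.

(** * Segments and the class Omega *)

Lemma line2 a b : adjacent a b -> in_row [:: a; b] \/ in_column [:: a; b].
Proof.
case: a => x y /adjacent_shared[e []].
- right; exists (y - 1), y, x => -[u v]; rewrite !inE !xpair_eqE /=; split; lia.
- right; exists y, (y + 1), x => -[u v]; rewrite !inE !xpair_eqE /=; split; lia.
- left; exists (x - 1), x, y => -[u v]; rewrite !inE !xpair_eqE /=; split; lia.
- left; exists x, (x + 1), y => -[u v]; rewrite !inE !xpair_eqE /=; split; lia.
Qed.

Lemma line3 a m b : adjacent m a -> adjacent m b -> a != b -> ~~ turns a b ->
  in_row [:: a; m; b] \/ in_column [:: a; m; b].
Proof.
case: m => x y ma mb nab; rewrite /turns.
have [e1 S1] := adjacent_shared ma; have [e2 S2] := adjacent_shared mb.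
case: S1 nab {ma} => nab; case: S2 nab {mb} => nab //=; rewrite ?eqxx // in nab *; try lia => _.
- right; exists (y - 1), (y + 1), x => -[u v]; rewrite !inE !xpair_eqE /=; split; lia.
- right; exists (y - 1), (y + 1), x => -[u v]; rewrite !inE !xpair_eqE /=; split; lia.
- left; exists (x - 1), (x + 1), y => -[u v]; rewrite !inE !xpair_eqE /=; split; lia.
- left; exists (x - 1), (x + 1), y => -[u v]; rewrite !inE !xpair_eqE /=; split; lia.
Qed.

Section Subchains.
Variables (G : graph point) (C : seq cell).
Hypotheses (PG : polyomino_system G) (CO : chain_order G C).
Local Notation c := (nth (0, 0) C).
Local Notation n := (size C).

Lemma subchain_nth a b i :
  (a + i <= b)%N -> nth (0, 0) (subchain C a b) i = c (a + i).
Proof. by move=> ib; rewrite /subchain nth_drop nth_take. Qed.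

Lemma size_subchain a b : (b < n)%N -> size (subchain C a b) = (b.+1 - a)%N.
Proof. by move=> nb; rewrite size_drop size_takel. Qed.

Lemma subchain_sub a b : {subset subchain C a b <= C}.
Proof. by move=> d /mem_drop/mem_take. Qed.

Lemma mem_subchain a b j : (a <= j <= b)%N -> (b < n)%N -> c j \in subchain C a b.
Proof.
case/andP=> aj jb nb; rewrite -(subnKC aj) -(@subchain_nth a b); last by rewrite subnKC.
by rewrite mem_nth // size_subchain //; lia.
Qed.

Lemma subchain2 k : (k.+1 < n)%N -> subchain C k k.+1 = [:: c k; c k.+1].
Proof.
move=> nk; have E : (k.+2 - k = 2)%N by lia.
apply: (@eq_from_nth _ (0, 0)) => [|i]; rewrite size_subchain // E //.
by case: i => [|[|i]] // _; rewrite subchain_nth ?addn0 ?addn1.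
Qed.

Lemma subchain3 k : (k.+2 < n)%N ->
  subchain C k k.+2 = [:: c k; c k.+1; c k.+2].
Proof.
move=> nk; have E : (k.+3 - k = 3)%N by lia.
apply: (@eq_from_nth _ (0, 0)) => [|i]; rewrite size_subchain // E //.
by case: i => [|[|[|i]]] // _; rewrite subchain_nth ?addn0 ?addn1 ?addn2 //; lia.
Qed.

Lemma subchain_adjacent a b i j : (b < n)%N ->
    (i < size (subchain C a b))%N -> (j < size (subchain C a b))%N ->
  adjacent (nth (0, 0) (subchain C a b) i) (nth (0, 0) (subchain C a b) j)
    = (j == i.+1) || (i == j.+1).
Proof.
move=> nb; rewrite size_subchain // => ib jb.
by rewrite !subchain_nth ?(chain_adjacent CO); lia.
Qed.

Lemma subchain_uniq a b : uniq (subchain C a b).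
Proof. by rewrite drop_uniq // take_uniq // (chain_uniq CO). Qed.

Lemma linear_pair k : (k.+1 < n)%N -> linear_subchain C k k.+1.
Proof.
move=> nk; split; first by rewrite leqnSn.
have S2 := subchain2 nk; have adj := consecutive_adjacent CO nk.
rewrite (_ : (k.+1 - k).+1 = size (subchain C k k.+1)); last first.
  by rewrite S2 /=; lia.
apply: straight_linear; rewrite ?subchain_uniq ?S2 //.
- exact: line2.
- by apply: two_connected_cons => //; apply: two_connected_seq1.
- by rewrite -S2 => i j; apply: subchain_adjacent.
Qed.

Lemma linear_triple k : (k.+2 < n)%N -> ~~ bend C k.+1 ->
  linear_subchain C k k.+2.
Proof.
move=> nk; rewrite /bend /= nk /= => T; split; first by rewrite nk -addn2 leq_addr.
have S3 := subchain3 nk; have [a1 a2 a3] := middle_cells CO nk.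
rewrite (_ : (k.+2 - k).+1 = size (subchain C k k.+2)); last first.
  by rewrite S3 /=; lia.
apply: straight_linear; rewrite ?subchain_uniq ?S3 //.
- exact: line3.
- apply: two_connected_cons => //; first by rewrite adjacent_sym.
  by apply: two_connected_cons => //; apply: two_connected_seq1.
- by rewrite -S3 => i j; apply: subchain_adjacent.
- by rewrite /bend /= (negbTE T).
Qed.

(** The outer corner of a bend has degree two in every subchain through the
    bend, which therefore has a kink there. *)
Lemma linear_subchain_straight a b j : linear_subchain C a b -> (a < j < b)%N ->
  bend C j = false.
Proof.
case=> /andP[ab nb] [[PH _ [C' [CO' _]]] nokink] /andP[aj jb]; apply/negP => bj.
case: j aj jb bj => // j aj jb bj; have [v vj dv] := bend_outer PG CO bj.
set H := graph_of_cells _ in PH CO' nokink.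
have [nj nj2] : (j < n)%N /\ (j.+2 < n)%N by split; lia.
have [a1 a2 /eqP a3] := middle_cells CO nj2.
have sq i : (a <= i <= b)%N -> square H (c i).
  by move=> ib; apply/sides_square/sides_sub_graph/mem_subchain.
apply: (nokink (c j.+1)); split.
  split; first by apply: sq; lia.
  by exists (c j), (c j.+2); split=> //; split=> //; apply: sq; lia.
exists v; split=> //; apply/eqP; rewrite eqn_leq; apply/andP; split.
  rewrite -dv fsubset_leq_card //; apply/fsubsetP => e; rewrite !inE.
  case/andP=> eH ->; rewrite andbT; move: eH; rewrite in_graph_of_cells.
  case/hasP=> d /subchain_sub dC ed; rewrite (chain_edge PG CO).
  by apply/hasP; exists d.
have : c j.+1 \in C' by apply/(chain_square CO')/sq; lia.
case/(nthP (0, 0)) => k nk Ek.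
have tk : touches C' v k by rewrite /touches nk Ek.
rewrite (degree_count PH CO' tk) ltnS -has_count; apply/hasP.
by exists (c j.+1); rewrite // -Ek mem_nth.
Qed.

Lemma segment_extend a b : linear_subchain C a b ->
  exists a' b', [/\ segment C a' b', (a' <= a)%N & (b <= b')%N].
Proof.
have [m] := ubnP (a + (n - b)); elim: m a b => // m IH a b mab lab.
have [smax|] := EM (segment C a b); first by exists a, b.
move=> nseg; have [a1 [b1 [l1 aa bb ne]]] : exists a' b',
    [/\ linear_subchain C a' b', (a' <= a)%N, (b <= b')%N & (a', b') <> (a, b)].
  apply: contrapT => no; apply: nseg; split=> // a' b' l' a'a bb'.
  have [[-> ->]//|ne] := EM ((a', b') = (a, b)).
  by case: no; exists a', b'.
have nb1 : (b1 < n)%N by case: l1 => /andP[].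
have [|a2 [b2 [s2 a2a b2b]]] := IH a1 b1 _ l1.
  have : (a1 < a)%N \/ (b < b1)%N.
    have [E|N] := eqVneq a1 a; last by left; lia.
    have [E'|N'] := eqVneq b1 b; last by right; lia.
    by rewrite E E' in ne.
  lia.
by exists a2, b2; split=> //; [apply: leq_trans aa | apply: leq_trans b2b].
Qed.

(** A longer linear subchain would contain a bend in its interior, and so would
    one that contains the second bend, its successor and the straight cell. *)
Lemma internal_triple k : bend C k -> ~~ bend C k.+1 -> bend C k.+2 ->
  internal_segment C k k.+2.
Proof.
move=> bk bk1 bk2; have nk3 : (k.+3 < n)%N by case/and3P: bk2.
have nk2 : (k.+2 < n)%N by apply: ltnW.
case: k bk bk1 bk2 nk3 nk2 => // k bk bk1 bk2 nk3 nk2; split.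
- split; first exact: linear_triple.
  move=> a b lab ak kb; split; apply/eqP.
    have [ka|] := ltnP a k.+1; last by lia.
    by have := linear_subchain_straight lab (j := k.+1); rewrite bk; lia.
  have [kb'|] := ltnP k.+3 b; last by lia.
  by have := linear_subchain_straight lab (j := k.+3); rewrite bk2; lia.
- have [|a [b [sab ak kb]]] := segment_extend (@linear_pair k _).
    by do 2!apply: ltnW.
  by exists a, b; split=> //; rewrite ltnS.
- have [//|a [b [sab ak kb]]] := segment_extend (@linear_pair k.+3 _).
  exists a, b; split=> //; have [lab _] := sab.
  have := linear_subchain_straight lab (j := k.+3); rewrite bk2.
  by case: ltnP => //; lia.
Qed.

End Subchains.

(** A straight cell between two bends is the middle of an internal segment of
    length three. *)
Lemma Omega_no_U_turn m G C : Omega m G -> chain_order G C ->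
  forall k, (k.+2 < size C)%N -> no_U_turn G C k.
Proof.
move=> [[PG _ _] om] CO k nk bk bk1 bk2 u v uv [du dv].
apply: (om C k k.+2 CO (internal_triple PG CO bk bk1 bk2)).
  by rewrite subchain3.
exists u, v; split=> //; rewrite /edge in_graph_of_cells.
by apply/hasP; exists (nth (0, 0) C k.+1); rewrite // mem_subchain //; lia.
Qed.

(** * Congruence and isomorphism *)

Definition edge_image (f : point -> point) (G : graph point) : graph point :=
  [fset f @` (e : {fset point}) | e in G].

Lemma edge_imageP f (G : graph point) e :
  reflect (exists2 e', e' \in G & e = f @` e') (e \in edge_image f G).
Proof. exact: imfsetP. Qed.

Lemma imfset_id_in (T : choiceType) (f g : T -> T) (A : {fset T}) :
  cancel f g -> g @` (f @` A) = A.
Proof.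
move=> fK; apply/fsetP => x; apply/imfsetP/idP => /= [[y /imfsetP[z zA ->] ->]|xA].
  by rewrite fK.
by exists (f x); rewrite ?fK //; apply/imfsetP; exists x.
Qed.

(** Below, the permutations of the lattice points are symmetries of the lattice;
    a two-sided inverse makes the relation symmetric without further
    conditions. *)
Definition congruent (G H : graph point) : Prop :=
  exists f g, [/\ cancel f g, cancel g f & H = edge_image f G].

Lemma congruent_sym G H : congruent G H -> congruent H G.
Proof.
case=> f [g [fK gK ->]]; exists g, f; split=> //; apply/fsetP => e.
apply/idP/edge_imageP => [eG|[e' /edge_imageP[e'' eG ->] ->]].
  by exists (f @` e); rewrite ?(imfset_id_in _ fK) //; apply/edge_imageP; exists e.
by rewrite (imfset_id_in _ fK).
Qed.

Lemma congruent_trans G H K : congruent G H -> congruent H K -> congruent G K.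
Proof.
case=> f [f' [fK f'K ->]] [g [g' [gK g'K ->]]].
have comp (e : {fset point}) : (g \o f) @` e = g @` (f @` e).
  apply/fsetP => x; apply/imfsetP/imfsetP => /= [[y ye ->]|[y /imfsetP[z ze ->] ->]].
    by exists (f y) => //; apply/imfsetP; exists y.
  by exists z.
exists (g \o f), (f' \o g'); split; [exact: can_comp|exact: can_comp|].
apply/fsetP => e; apply/edge_imageP/edge_imageP.
  by case=> e' /edge_imageP[e'' eG ->] ->; exists e''; rewrite ?comp.
by case=> e' eG ->; exists (f @` e'); rewrite ?comp //; apply/edge_imageP; exists e'.
Qed.

Lemma congruent_isomorphic G H : congruent G H -> isomorphic G H.
Proof.
case=> f [g [fK gK ->]]; have fI := can_inj fK; exists f; split.
- by move=> u v _ _; apply: fI.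
- apply/fsetP => x; apply/imfsetP/bigfcupP => /=.
    case=> v /bigfcupP[e]; rewrite andbT => eG ve ->; exists (f @` e).
      by rewrite andbT; apply/edge_imageP; exists e.
    by apply/imfsetP; exists v.
  case=> e'; rewrite andbT => /edge_imageP[e eG ->] /imfsetP[v /= ve ->].
  by exists v => //; apply/bigfcupP; exists e; rewrite ?andbT.
move=> u v _ _; rewrite /edge -imfset_fset2; apply/idP/edge_imageP => [uv|].
  by exists [fset u; v].
by case=> e eG /(congr1 (fun A => g @` A)); rewrite !(imfset_id_in _ fK) => ->.
Qed.

(** * Invariance of the indices under isomorphism *)

Section Isomorphism.
Variables (G H : graph point) (f : point -> point).
Hypotheses (GL : lattice_graph G) (HL : lattice_graph H).
Hypotheses (fI : {in vertices G &, injective f}) (fV : f @` vertices G = vertices H)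
  (fE : {in vertices G &, forall u v, edge G u v = edge H (f u) (f v)}).

Lemma lattice_pair (K : graph point) e : lattice_graph K -> e \in K ->
  exists u v, e = [fset u; v].
Proof.
by move=> KL /KL[c /sides_edge[] [x [y ->]]]; do 2!eexists.
Qed.

Lemma edge_sub e : e \in G -> e `<=` vertices G.
Proof.
by move=> eG; apply/fsubsetP => v ve; apply/bigfcupP; exists e; rewrite ?andbT.
Qed.

Lemma isomorphic_image : H = edge_image f G.
Proof.
apply/fsetP => e; apply/idP/edge_imageP => [eH|[e' eG ->]]; last first.
  have [u [v E]] := lattice_pair GL eG; rewrite E in eG *; rewrite imfset_fset2.
  by have [uG vG] := edge_vertices eG; move: (fE uG vG); rewrite /edge eG => <-.
have [u [v E]] := lattice_pair HL eH; rewrite E in eH *.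
have [] := edge_vertices eH; rewrite -fV => /imfsetP[a /= aG Ea] /imfsetP[b /= bG Eb].
exists [fset a; b]; last by rewrite imfset_fset2 Ea Eb.
by have := fE aG bG; rewrite /edge -Ea -Eb eH.
Qed.

Lemma imfset_edge_inj : {in G &, injective (fun e : {fset point} => f @` e)}.
Proof.
move=> e1 e2 /edge_sub/fsubsetP s1 /edge_sub/fsubsetP s2 /fsetP E.
have sub (a b : {fset point}) : {subset a <= vertices G} -> {subset b <= vertices G} ->
    f @` a =i f @` b -> {subset a <= b}.
  move=> aG bG ab x xa; have : f x \in f @` b by rewrite -ab; apply/imfsetP; exists x.
  by case/imfsetP => y /= yb fxy; rewrite (fI (aG _ xa) (bG _ yb) fxy).
by apply/fsetP => x; apply/idP/idP; apply: sub.
Qed.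

Lemma isomorphic_degree v : v \in vertices G -> degree H (f v) = degree G v.
Proof.
move=> vG; rewrite /degree.
have -> : [fset e in H | f v \in e] = edge_image f [fset e in G | v \in e].
  apply/fsetP => e; rewrite isomorphic_image !inE; apply/andP/edge_imageP.
    case=> /edge_imageP[e' eG ->] /imfsetP[w /= we Ev]; exists e' => //.
    have wG := fsubsetP (edge_sub eG) _ we.
    by rewrite !inE eG (fI vG wG Ev).
  case=> e'; rewrite !inE => /andP[eG ve] ->; split.
    by apply/edge_imageP; exists e'.
  by apply/imfsetP; exists v.
rewrite card_in_imfset //= => e1 e2; rewrite !inE => /andP[e1G _] /andP[e2G _].
exact: imfset_edge_inj.
Qed.

Lemma isomorphic_sum (V : nmodType) (F : {fset point} -> V) :
  \sum_(e <- H) F e = \sum_(e <- G) F (f @` e).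
Proof. by rewrite isomorphic_image /edge_image big_imfset //; apply: imfset_edge_inj. Qed.

Lemma isomorphic_big (V : Type) (idx : V) (op : Monoid.com_law idx) (F : nat -> V) e :
  e \in G -> \big[op/idx]_(v <- f @` e) F (degree H v)
             = \big[op/idx]_(v <- e) F (degree G v).
Proof.
move=> eG; have sub := fsubsetP (edge_sub eG).
rewrite big_imfset => [|u v /sub uG /sub vG]; last exact: fI.
rewrite /= !big_seq; apply: eq_bigr => v /sub vG.
by rewrite isomorphic_degree.
Qed.

End Isomorphism.

(** * Congruence of straight and of zigzag chains *)

(** The images of the two unit vectors under a symmetry of the square. *)
Definition unit_frame (d0 d1 : cell) : Prop :=
  (d0.2 = 0 /\ d1.1 = 0 /\ `|d0.1| = 1 /\ `|d1.2| = 1) \/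
  (d0.1 = 0 /\ d1.2 = 0 /\ `|d0.2| = 1 /\ `|d1.1| = 1).

Definition move_cell (o d0 d1 d : cell) : cell :=
  (o.1 + d.1 * d0.1 + d.2 * d1.1, o.2 + d.1 * d0.2 + d.2 * d1.2).

(** A cell is named by its lower left corner, which a reflection moves to
    another corner: hence the correction by one. *)
Definition move_point (o d0 d1 : cell) (v : point) : point :=
  (o.1 + v.1 * d0.1 + v.2 * d1.1 + (d0.1 + d1.1 == - 1)%:R,
   o.2 + v.1 * d0.2 + v.2 * d1.2 + (d0.2 + d1.2 == - 1)%:R).

Definition move_back (o d0 d1 : cell) (v : point) : point :=
  let x := v.1 - o.1 - (d0.1 + d1.1 == - 1)%:R in
  let y := v.2 - o.2 - (d0.2 + d1.2 == - 1)%:R in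
  (x * d0.1 + y * d0.2, x * d1.1 + y * d1.2).

Lemma unit_frame_cases (P : cell -> cell -> Prop) :
  P (1, 0) (0, 1) -> P (1, 0) (0, - 1) -> P (- 1, 0) (0, 1) ->
  P (- 1, 0) (0, - 1) -> P (0, 1) (1, 0) -> P (0, 1) (- 1, 0) ->
  P (0, - 1) (1, 0) -> P (0, - 1) (- 1, 0) ->
  forall d0 d1, unit_frame d0 d1 -> P d0 d1.
Proof.
have norm1 (z : int) : `|z| = 1 -> z = 1 \/ z = - 1 by lia.
move=> P1 P2 P3 P4 P5 P6 P7 P8 [a b] [c d] [] /= [-> [-> [/norm1 A /norm1 B]]];
  by case: A => ->; case: B => ->.
Qed.

Lemma move_pointK o d0 d1 : unit_frame d0 d1 ->
  cancel (move_point o d0 d1) (move_back o d0 d1).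
Proof.
move=> u01 [x y]; case: o => o1 o2; rewrite /move_back /move_point.
by elim/unit_frame_cases: d0 d1 / u01; rewrite /=; congr pair; lia.
Qed.

Lemma move_backK o d0 d1 : unit_frame d0 d1 ->
  cancel (move_back o d0 d1) (move_point o d0 d1).
Proof.
move=> u01 [x y]; case: o => o1 o2; rewrite /move_back /move_point.
by elim/unit_frame_cases: d0 d1 / u01; rewrite /=; congr pair; lia.
Qed.

Lemma move_point_sides o d0 d1 c : unit_frame d0 d1 ->
  sides (move_cell o d0 d1 c) = edge_image (move_point o d0 d1) (sides c).
Proof.
case: o c => o1 o2 [x y] u01; apply/esym/eqP.
(* One inclusion suffices, as both sides have four elements. *)
have sub : edge_image (move_point (o1, o2) d0 d1) (sides (x, y))
    `<=` sides (move_cell (o1, o2) d0 d1 (x, y)).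
  apply/fsubsetP => e /edge_imageP[e' + ->].
  by rewrite in_sides /move_cell /move_point; move: u01;
    elim/unit_frame_cases: d0 d1 / => /or4P[] /eqP->;
    rewrite imfset_fset2 in_sides /= !eq_fset2 !xpair_eqE; lia.
have card4 d : #|` sides d| = 4%N.
  by case: d => a b; case: (quad_cell a b) => /perm_size.
rewrite eqEfcard sub /= card4 card_imfset /=.
  by rewrite -(card4 (x, y)).
move=> e1 e2 E; rewrite -(imfset_id_in e1 (move_pointK (o1, o2) u01)) E.
by rewrite (imfset_id_in _ (move_pointK _ u01)).
Qed.

Lemma move_cells_congruent o d0 d1 s : unit_frame d0 d1 ->
  congruent (graph_of_cells s) (graph_of_cells (map (move_cell o d0 d1) s)).
Proof.
move=> u01; exists (move_point o d0 d1), (move_back o d0 d1); split.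
- exact: move_pointK.
- exact: move_backK.
apply/fsetP => e; rewrite in_graph_of_cells has_map.
apply/hasP/edge_imageP => [[d ds]|[e']] /=.
  rewrite (move_point_sides _ _ u01) => /edge_imageP[e' e'd ->]; exists e' => //.
  by rewrite in_graph_of_cells; apply/hasP; exists d.
rewrite in_graph_of_cells => /hasP[d ds e'd] ->; exists d => //=.
by rewrite (move_point_sides _ _ u01); apply/edge_imageP; exists e'.
Qed.

Lemma opposite_cells a m b : ~~ turns a b -> a != b ->
    adjacent m a -> adjacent m b ->
  b.1 = m.1 + (m.1 - a.1) /\ b.2 = m.2 + (m.2 - a.2).
Proof.
case: m => x y; rewrite /turns.
move=> t nab /adjacent_shared[ea Sa] /adjacent_shared[eb Sb].
case: Sa t nab => t nab; case: Sb t nab => t;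
  by rewrite ?xpair_eqE ?eqxx /= in t *; lia.
Qed.

(** Two successive turns to the same side would close up a block of four
    cells, so that the turns alternate. *)
Lemma alternating_turns a m b d : turns a b -> turns m d -> ~~ adjacent a d ->
    adjacent m a -> adjacent m b -> adjacent b d ->
  d.1 = b.1 + (m.1 - a.1) /\ d.2 = b.2 + (m.2 - a.2).
Proof.
case: m => x y t1 t2 nad /adjacent_shared[ea Sa] /adjacent_shared[eb Sb].
rewrite /turns in t1 t2.
case: Sa t1 nad => t1 nad; case: Sb t2 t1 => t2 /=;
  rewrite ?eqxx ?andbF // => t1 /adjacent_shared[ed Sd];
  case: Sd t2 nad => t2; rewrite ?adjacentE ?addrK ?subrK /=;
  by rewrite /= ?eqxx ?andbF // in t2; lia.
Qed.

Definition straight_cells n : seq cell := mkseq (fun k => (k%:Z, 0)) n.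

Definition zigzag_cells n : seq cell := mkseq (fun k => ((uphalf k)%:Z, (half k)%:Z)) n.

Section Shapes.
Variables (G : graph point) (C : seq cell).
Hypotheses (PG : polyomino_system G) (CO : chain_order G C).
Hypothesis size3 : (3 <= size C)%N.
Local Notation c := (nth (0, 0) C).
Local Notation n := (size C).

Lemma chain_graph : G = graph_of_cells C.
Proof. by apply/fsetP => e; rewrite (chain_edge PG CO) in_graph_of_cells. Qed.

Lemma straight_step k : (k.+2 < n)%N -> bend C k.+1 = false ->
  (c k.+2).1 = (c k.+1).1 + ((c k.+1).1 - (c k).1) /\
  (c k.+2).2 = (c k.+1).2 + ((c k.+1).2 - (c k).2).
Proof.
move=> nk; rewrite /bend /= nk /= => /negbT t; have [a1 a2 a3] := middle_cells CO nk.
exact: opposite_cells.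
Qed.

Lemma zigzag_step k : (k.+3 < n)%N -> bend C k.+1 -> bend C k.+2 ->
  (c k.+3).1 = (c k.+2).1 + ((c k.+1).1 - (c k).1) /\
  (c k.+3).2 = (c k.+2).2 + ((c k.+1).2 - (c k).2).
Proof.
move=> nk /and3P[_ _ /= t1] /and3P[_ _ /= t2].
have [nk0 nk2] : (k < n)%N /\ (k.+2 < n)%N by split; lia.
have [a1 a2 _] := middle_cells CO nk2; have [_ a3 _] := middle_cells CO nk.
apply: alternating_turns t1 t2 _ a1 a2 a3.
by rewrite (chain_adjacent CO) //; lia.
Qed.

Lemma straight_congruent : (forall k, (k.+2 < n)%N -> bend C k.+1 = false) ->
  congruent (graph_of_cells (straight_cells n)) G.
Proof.
move=> nob; have n1 : (1 < n)%N by apply: ltnW.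
pose d0 : cell := ((c 1).1 - (c 0).1, (c 1).2 - (c 0).2).
have u01 : unit_frame d0 (d0.2, d0.1).
  have := consecutive_adjacent CO n1; rewrite adjacentE /unit_frame /d0 /=.
  by case: (c 0) (c 1) => a b [a' b'] /=; lia.
suff -> : G = graph_of_cells (map (move_cell (c 0) d0 (d0.2, d0.1)) (straight_cells n)).
  exact: move_cells_congruent.
rewrite {1}chain_graph; congr graph_of_cells; apply: (@eq_from_nth _ (0, 0)).
  by rewrite size_map size_mkseq.
move=> k nk; rewrite (nth_map (0, 0)) ?size_mkseq // nth_mkseq //.
have closed j : (j.+1 < n)%N -> 
    (c j = move_cell (c 0) d0 (d0.2, d0.1) (j%:Z, 0)) /\
    (c j.+1 = move_cell (c 0) d0 (d0.2, d0.1) (j.+1%:Z, 0)).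
  elim: j => [_|j IH nj].
    by rewrite /move_cell /d0 /=; case: (c 0) (c 1) => a b [a' b'] /=; split; congr pair; lia.
  have [E0 E1] := IH (ltnW nj); split=> //.
  have [] := straight_step nj (nob _ nj); rewrite E0 E1; case: (c j.+2) => a b.
  by rewrite /move_cell /= => -> ->; congr pair; lia.
case: k nk => [_|k nk]; first by case: (closed _ n1).
by case: (closed k nk).
Qed.

Lemma zigzag_congruent : (forall k, (k.+2 < n)%N -> bend C k.+1) ->
  congruent (graph_of_cells (zigzag_cells n)) G.
Proof.
move=> allb; have n1 : (1 < n)%N by apply: ltnW.
pose d0 : cell := ((c 1).1 - (c 0).1, (c 1).2 - (c 0).2).
pose d1 : cell := ((c 2).1 - (c 1).1, (c 2).2 - (c 1).2).
have u01 : unit_frame d0 d1.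
  have [+ + _] := middle_cells CO size3; have /and3P[_ _ /=] := allb _ size3.
  rewrite !adjacentE /turns /unit_frame /d0 /d1 /=.
  by case: (c 0) (c 1) (c 2) => x0 y0 [x1 y1] [x2 y2] /=; lia.
suff -> : G = graph_of_cells (map (move_cell (c 0) d0 d1) (zigzag_cells n)).
  exact: move_cells_congruent.
rewrite {1}chain_graph; congr graph_of_cells; apply: (@eq_from_nth _ (0, 0)).
  by rewrite size_map size_mkseq.
move=> k nk; rewrite (nth_map (0, 0)) ?size_mkseq // nth_mkseq //.
pose z j : cell := move_cell (c 0) d0 d1 ((uphalf j)%:Z, (half j)%:Z).
have closed j : (j.+2 < n)%N -> [/\ c j = z j, c j.+1 = z j.+1 & c j.+2 = z j.+2].
  elim: j => [_|j IH nj].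
    rewrite /z /move_cell /d0 /d1 /=; case: (c 0) (c 1) (c 2) => x0 y0 [x1 y1] [x2 y2] /=.
    by split; congr pair; lia.
  have [E0 E1 E2] := IH (ltnW nj); split=> //.
  have [] := zigzag_step nj (allb _ (ltnW nj)) (allb _ nj).
  rewrite E0 E1 E2; case: (c j.+3) => a b.
  by rewrite /z /move_cell /= => -> ->; congr pair; lia.
case: k nk => [|[|k]] nk.
- by case: (closed 0 size3).
- by case: (closed 0 size3).
- by case: (closed k nk).
Qed.

End Shapes.

(** * Inequalities between powers *)

Section PowerInequalities.
Variable R : realType.
Implicit Types (x y z g : R).

Lemma ln_lt_sub1 x : 0 < x -> x != 1 -> ln x < x - 1.
Proof.
move=> x0 x1; rewrite ltrBrDl -[X in _ < X]lnK ?posrE //.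
by rewrite expR_gt1Dx // ln_eq0.
Qed.

(** Strict concavity of the logarithm: with [m := 1 + g * (x - 1)], the bounds
    of [ln (x / m)] and [ln m^-1] by the tangent of the logarithm at one cancel
    in the mean with weights [g] and [1 - g]. *)
Lemma powR_lt_tangent x g :
  0 < g < 1 -> 0 < x -> x != 1 -> x `^ g < 1 + g * (x - 1).
Proof.
move=> /andP[g0 g1] x0 x1; set m := 1 + g * (x - 1).
have m0 : 0 < m by rewrite /m; nra.
rewrite -(@ltr_ln _ (x `^ g) m) ?posrE ?powR_gt0 // ln_powR.
have mN0 : m != 0 by rewrite lt0r_neq0.
have xm : x / m != 1.
  apply: contra x1 => /eqP /(congr1 ( *%R^~ m)); rewrite divfK // mul1r /m => E.
  have : (1 - g) * (x - 1) = 0 by lra.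
  by move/eqP; rewrite mulf_eq0 !subr_eq0 => /orP[/eqP|//] ; lra.
have l1 := ln_lt_sub1 (divr_gt0 x0 m0) xm.
have l2 : ln m^-1 <= m^-1 - 1.
  have := @le_ln1Dx R (m^-1 - 1); rewrite [1 + _]addrC subrK; apply.
  by rewrite ltrBrDr addNr invr_gt0.
move: l1 l2; rewrite ln_div ?lnV ?posrE // => l1 l2.
have id0 : g * (x / m) + (1 - g) / m = 1.
  by rewrite mulrA -mulrDl (_ : g * x + (1 - g) = m) ?divff // /m; ring.
nra.
Qed.

(** The previous lemma for the exponent [g^-1], raised to the power [g]. *)
Lemma powR_gt_tangent x g :
  1 < g -> 0 < x -> x != 1 -> 1 + g * (x - 1) < x `^ g.
Proof.
move=> g1 x0 x1; set y := 1 + g * (x - 1).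
have [y0|y0] := leP y 0; first by apply: le_lt_trans y0 _; apply: powR_gt0.
have g0 : 0 < g by apply: lt_trans g1.
have y1 : y != 1.
  by rewrite -subr_eq0 /y addrAC subrr add0r mulf_eq0 negb_or subr_eq0 x1 lt0r_neq0.
have gi : 0 < g^-1 < 1 by rewrite invr_gt0 g0 invf_lt1.
have := powR_lt_tangent gi y0 y1.
have -> : 1 + g^-1 * (y - 1) = x by rewrite /y; field; rewrite lt0r_neq0.
move=> lt; rewrite -[y](powRr1 (ltW y0)) -(mulVf (lt0r_neq0 g0)) powRrM.
by apply: gt0_ltr_powR; rewrite ?nnegrE ?powR_ge0 ?ltW.
Qed.

Lemma powR_scale x z g : 0 < x -> 0 < z -> x `^ g = z `^ g * (x / z) `^ g.
Proof.
move=> x0 z0; rewrite -powRM ?divr_ge0 ?ltW // mulrC divfK //.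
exact: lt0r_neq0.
Qed.

Lemma powR_strict_convex x z g : 1 < g -> 0 < x -> 0 < z -> x != z ->
  z `^ g * (1 + g * (x / z - 1)) < x `^ g.
Proof.
move=> g1 x0 z0 xz; rewrite (powR_scale g x0 z0) ltr_pM2l ?powR_gt0 //.
apply: powR_gt_tangent; rewrite ?divr_gt0 //.
by apply: contra xz => /eqP E; rewrite -[x](divfK (lt0r_neq0 z0)) E mul1r.
Qed.

(** The tangent at [z], written so that its slope is a multiple of [z `^ g]:
    suitable combinations of such bounds cancel the terms with [g]. *)
Lemma powR_convex x z g : 1 <= g -> 0 < x -> 0 < z ->
  z `^ g * (1 + g * (x / z - 1)) <= x `^ g.
Proof.
move=> g1 x0 z0; rewrite (powR_scale g x0 z0) ler_pM2l ?powR_gt0 //.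
have [->|q1] := eqVneq (x / z) 1; first by rewrite subrr mulr0 addr0 powR1.
move: g1; rewrite le_eqVlt => /predU1P[<-|g1].
  by rewrite (powRr1 (ltW (divr_gt0 x0 z0))) mul1r addrC subrK.
by apply/ltW/powR_gt_tangent; rewrite ?divr_gt0.
Qed.

Lemma powR_concave x z g : 0 < g <= 1 -> 0 < x -> 0 < z ->
  x `^ g <= z `^ g * (1 + g * (x / z - 1)).
Proof.
move=> /andP[g0 g1] x0 z0.
rewrite (powR_scale g x0 z0) ler_pM2l ?powR_gt0 //.
have [->|q1] := eqVneq (x / z) 1; first by rewrite subrr mulr0 addr0 powR1.
move: g1; rewrite le_eqVlt => /predU1P[->|g1].
  by rewrite (powRr1 (ltW (divr_gt0 x0 z0))) mul1r addrC subrK.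
by apply/ltW/powR_lt_tangent; rewrite ?divr_gt0 ?g0.
Qed.

Lemma powR_lt x y g : 0 < g -> 0 < x -> x < y -> x `^ g < y `^ g.
Proof.
move=> g0 x0 xy; apply: gt0_ltr_powR => //; rewrite nnegrE ?ltW //.
exact: lt_trans xy.
Qed.

(** The inequality of arithmetic and geometric means for two powers. *)
Lemma powR_amgm2 x y z g : 0 < g -> 0 < x -> 0 < y -> 0 < z ->
  z ^+ 2 < x * y -> 2 * z `^ g < x `^ g + y `^ g.
Proof.
move=> g0 x0 y0 z0 /(powR_lt g0 (exprn_gt0 _ z0)).
rewrite expr2 !powRM ?ltW //.
have := powR_gt0 g x0; have := powR_gt0 g y0; have := powR_gt0 g z0.
move: (x `^ g) (y `^ g) (z `^ g) => u v w w0 v0 u0 lt.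
have := sqr_ge0 (u - v); nra.
Qed.

(** The same for three powers, two of which are equal. *)
Lemma powR_amgm3 x y z g : 0 < g -> 0 < x -> 0 < y -> 0 < z ->
  z ^+ 3 < x ^+ 2 * y -> 3 * z `^ g < 2 * x `^ g + y `^ g.
Proof.
move=> g0 x0 y0 z0 /(powR_lt g0 (exprn_gt0 _ z0)).
rewrite exprS !expr2 !powRM ?mulr_ge0 ?ltW //.
have := powR_gt0 g x0; have := powR_gt0 g y0; have := powR_gt0 g z0.
move: (x `^ g) (y `^ g) (z `^ g) => u v w w0 v0 u0 lt.
rewrite ltNge; apply/negP => le.
have : u * u * v <= u * u * (3 * w - 2 * u).
  by rewrite ler_pM2l ?mulr_gt0 //; lra.
have : 0 <= (w - u) ^+ 2 * (w + 2 * u) by rewrite mulr_ge0 ?sqr_ge0 //; lra.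
nra.
Qed.

End PowerInequalities.

(** * The extremal chains *)

Section Extremal.
Variables (R : realType) (phi : nat -> nat -> R).
Variable W : graph point -> {fset point} -> R.
Hypothesis phiC : forall i j, phi i j = phi j i.
Hypothesis W_edge : forall G u v, u != v ->
  W G [fset u; v] = phi (degree G u) (degree G v).
Hypothesis W_iso : forall G H f e, lattice_graph G -> lattice_graph H ->
  {in vertices G &, injective f} -> f @` vertices G = vertices H ->
  {in vertices G &, forall u v, edge G u v = edge H (f u) (f v)} ->
  e \in G -> W H (f @` e) = W G e.
(* The value of [end_bond] increases with its argument by the first inequality,
   that of [bond] with each argument by the other two. *)
Hypothesis end_lt : 2 * phi 3 3 < phi 3 4 + phi 2 4.
Hypothesis turn_lt : 3 * phi 3 3 < 2 * phi 3 4 + phi 2 3.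
Hypothesis twist_lt : 2 * phi 3 4 + phi 2 3 < phi 4 4 + 2 * phi 2 4.

Definition weight_sum (G : graph point) : R := \sum_(e <- G) W G e.

Lemma weight_sum_isomorphic G H : lattice_graph G -> lattice_graph H ->
  isomorphic G H -> weight_sum G = weight_sum H.
Proof.
move=> GL HL [f [fI fV fE]]; rewrite /weight_sum (isomorphic_sum GL HL fI fV fE).
by rewrite !big_seq; apply: eq_bigr => e eG; rewrite (W_iso GL HL fI fV fE).
Qed.

Lemma end_bondE t : end_bond phi t =
  if t then phi 3 4 + phi 2 3 + phi 2 4 else 2 * phi 3 3 + phi 2 3.
Proof.
case: t; rewrite /end_bond /rung /flank /=; first by [].
by rewrite mulr_natl mulr2n.
Qed.

Lemma bondE s t : bond phi s t =
  if s && t then phi 4 4 + 2 * phi 2 4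
  else if s || t then 2 * phi 3 4 + phi 2 3 else 3 * phi 3 3.
Proof.
case: s t => [] []; rewrite /bond /rung /flank /=.
- by rewrite mulr_natl mulr2n addrA.
- by rewrite -[phi (3 + true) _]/(phi 4 3) -[phi (3 - false) (3 + true)]/(phi 3 4)
    -[phi (3 - true) _]/(phi 2 3) (phiC 4 3); ring.
- by rewrite -[phi (3 + false) (3 + true)]/(phi 3 4)
    -[phi (3 - false) (3 + true)]/(phi 3 4) -[phi (3 - true) _]/(phi 2 3); ring.
- by rewrite -[phi (3 + false) _]/(phi 3 3) -[phi (3 - false) _]/(phi 3 3); ring.
Qed.

Definition chain_value (m : nat) (t : nat -> bool) : R :=
  (phi 2 2 + phi 2 3) *+ 2 + end_bond phi (t 1) + end_bond phi (t m.+1)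
    + \sum_(j < m) bond phi (t j.+1) (t j.+2).

Local Ltac ineq := move: end_lt turn_lt twist_lt; lra.

(** Each of the summands is least for indicators that are all false, and only
    then; hence so is their sum. *)
Lemma chain_value_min m t : let s0 := chain_value m (fun=> false) in
  s0 <= chain_value m t /\
  (chain_value m t = s0 -> forall k, (k <= m)%N -> t k.+1 = false).
Proof.
have E b : end_bond phi false <= end_bond phi b ?= iff ~~ b.
  by rewrite !end_bondE; case: b; split=> //; rewrite ?eqxx //;
    [ineq | apply/negbTE; rewrite lt_eqF //; ineq].
have B a b : bond phi false false <= bond phi a b ?= iff ~~ a && ~~ b.
  by rewrite !bondE /=; case: a b => [] []; split=> //; rewrite ?eqxx //=;
    (try ineq); apply/negbTE; rewrite lt_eqF //; ineq.
have S : \sum_(j < m) bond phi false false <= \sum_(j < m) bond phi (t j.+1) (t j.+2)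
    ?= iff [forall j : 'I_m, ~~ t j.+1 && ~~ t j.+2].
  by apply: leif_sum => j _; apply: B.
have C0 : (phi 2 2 + phi 2 3) *+ 2 <= (phi 2 2 + phi 2 3) *+ 2 ?= iff true.
  exact/leif_refl.
have T := leifD (leifD (leifD C0 (E (t 1))) (E (t m.+1))) S.
split; first by case: T.
move=> eqv [|k] km; case: T => _; rewrite -/(chain_value m (fun=> false)) -/(chain_value m t) eqv eqxx.
  by move/esym/andP=> [/andP[/andP[_ /negbTE]]].
move/esym/andP=> [_ /forallP/(_ (Ordinal km))/andP[_ /negbTE]].
by [].
Qed.

Lemma chain_value_max m t : let s1 := chain_value m (fun=> true) in
  chain_value m t <= s1 /\
  (chain_value m t = s1 -> forall k, (k <= m)%N -> t k.+1).
Proof.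
have E b : end_bond phi b <= end_bond phi true ?= iff b.
  by rewrite !end_bondE; case: b; split=> //; rewrite ?eqxx //;
    [ineq | rewrite lt_eqF //; ineq].
have B a b : bond phi a b <= bond phi true true ?= iff a && b.
  by rewrite !bondE /=; case: a b => [] []; split=> //; rewrite ?eqxx //=;
    (try ineq); rewrite lt_eqF //; ineq.
have S : \sum_(j < m) bond phi (t j.+1) (t j.+2) <= \sum_(j < m) bond phi true true
    ?= iff [forall j : 'I_m, t j.+1 && t j.+2].
  by apply: leif_sum => j _; apply: B.
have C0 : (phi 2 2 + phi 2 3) *+ 2 <= (phi 2 2 + phi 2 3) *+ 2 ?= iff true.
  exact/leif_refl.
have T := leifD (leifD (leifD C0 (E (t 1))) (E (t m.+1))) S.
split; first by case: T.
move=> eqv [|k] km; case: T => _; rewrite -/(chain_value m (fun=> true)) -/(chain_value m t) eqv eqxx.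
  by move/esym/andP=> [/andP[/andP[_]]].
by move/esym/andP=> [_ /forallP/(_ (Ordinal km))/andP[_]].
Qed.

Lemma weight_sum_chain G C m : polyomino_system G -> chain_order G C ->
    size C = m.+3 -> (forall k, (k.+2 < size C)%N -> no_U_turn G C k) ->
  weight_sum G = chain_value m (bend C).
Proof. by move=> PG CO En; apply: (chain_sum PG CO phiC (@W_edge G) En). Qed.

Lemma eq_chain_value m t t' : (forall k, (k <= m)%N -> t k.+1 = t' k.+1) ->
  chain_value m t = chain_value m t'.
Proof.
move=> tt; rewrite /chain_value !tt //; congr (_ + _).
by apply: eq_bigr => j _; rewrite !tt // ltnW.
Qed.

(** The extreme values determine the indicators, and these determine the chain
    up to a symmetry of the lattice. *)
Lemma extremal_chains n (B L Z : graph point) :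
  (3 <= n)%N -> Omega n B -> linear_chain n L -> zigzag_chain n Z ->
  extremal_bounds weight_sum B L Z.
Proof.
case: n => [|[|[|m]]] // _ OB [[PL _ [CL [COL sL]]] nokink] [[PZ _ [CZ [COZ sZ]]] allkinks].
have [[PB _ [CB [COB sB]]] _] := OB.
have bL k : bend CL k = false by apply: no_kink_bend nokink.
have bZ k : (k.+2 < m.+3)%N -> bend CZ k.+1.
  by move=> km; apply: (all_kinks_bend PZ COZ allkinks); rewrite sZ.
have vB := weight_sum_chain PB COB sB (Omega_no_U_turn OB COB).
have vL : weight_sum L = chain_value m (fun=> false).
  rewrite (weight_sum_chain PL COL sL) => [|k _]; last by rewrite /no_U_turn bL.
  by apply: eq_chain_value => k _; apply: bL.
have vZ : weight_sum Z = chain_value m (fun=> true).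
  rewrite (weight_sum_chain PZ COZ sZ) => [|k km]; last first.
    by move=> _; rewrite bZ // -sZ.
  by apply: eq_chain_value => k km; rewrite bZ // !ltnS.
have [minB eqmin] := chain_value_min m (bend CB).
have [maxB eqmax] := chain_value_max m (bend CB).
have [[LB _ _] [LL _ _] [LZ _ _]] := And3 PB PL PZ.
have [nB nL nZ] : [/\ 2 < size CB, 2 < size CL & 2 < size CZ]%N.
  by rewrite sB sL sZ.
split; rewrite ?vB ?vL ?vZ //.
- split=> [E|iso]; last by rewrite -vB -vL; apply: weight_sum_isomorphic.
  have cB := straight_congruent PB COB nB; have cL := straight_congruent PL COL nL.
  rewrite sB in cB; rewrite sL in cL; apply/congruent_isomorphic.
  apply: congruent_trans (congruent_sym (cB _)) (cL _) => k km; last exact: bL.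
  exact: eqmin.
- split=> [E|iso]; last by rewrite -vB -vZ; apply: weight_sum_isomorphic.
  have cB := zigzag_congruent PB COB nB; have cZ := zigzag_congruent PZ COZ nZ.
  rewrite sB in cB; rewrite sZ in cZ; apply/congruent_isomorphic.
  apply: congruent_trans (congruent_sym (cB _)) (cZ _) => k km; last exact: bZ.
  exact: eqmax.
Qed.

End Extremal.

Lemma big_fset2 (V : Type) (idx : V) (op : Monoid.com_law idx) (T : choiceType)
  (u v : T) (F : T -> V) : u != v ->
  \big[op/idx]_(x <- [fset u; v]) F x = op (F u) (F v).
Proof. by move=> uv; rewrite big_fsetU1 ?in_fset1 //= big_seq_fset1. Qed.

Section Indices.
Variables (R : realType) (gamma : R).

Lemma randic_extremal n (B L Z : graph point) : 0 < gamma ->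
  (3 <= n)%N -> Omega n B -> linear_chain n L -> zigzag_chain n Z ->
  extremal_bounds (randic gamma) B L Z.
Proof.
move=> g0; apply: (@extremal_chains R (fun i j => (i%:R * j%:R) `^ gamma)
  (fun G e => (\prod_(v <- e) (degree G v)%:R) `^ gamma)).
- by move=> i j; rewrite mulrC.
- by move=> G u v uv; rewrite big_fset2.
- move=> G H f e GL HL fI fV fE eG; congr (_ `^ _).
  exact: (isomorphic_big GL HL fI fV fE *%R (fun d => d%:R)).
- by apply: powR_amgm2 => //; lra.
- by apply: powR_amgm3 => //; lra.
(* With [h x := x `^ gamma] the claim is [2 h 12 + h 6 < h 16 + 2 h 8].  For
   [gamma >= 1] it follows from convexity, as [16 + 8 = 2 * 12]; for
   [gamma < 1] from concavity, as [3 * 8 = 2 * 6 + 12], and from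
   [h 12 = h 2 * h 6] and [h 16 = h 2 * h 8]. *)
- have c0 : (2 * 3 : R) `^ gamma < (2 * 4) `^ gamma by apply: powR_lt => //; lra.
  have [g1|g1] := leP 1 gamma.
    have p0 : (0 : R) < (3 * 4) `^ gamma by apply: powR_gt0; lra.
    have c1 : (3 * 4 : R) `^ gamma * (1 + gamma * ((4 * 4) / (3 * 4) - 1)) <= (4 * 4) `^ gamma.
      by apply: powR_convex => //; lra.
    have c2 : (3 * 4 : R) `^ gamma * (1 + gamma * ((2 * 4) / (3 * 4) - 1)) <= (2 * 4) `^ gamma.
      by apply: powR_convex => //; lra.
    rewrite (_ : 4 * 4 / (3 * 4) = 4 / 3) in c1; last by field.
    rewrite (_ : 2 * 4 / (3 * 4) = 2 / 3) in c2; last by field.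
    lra.
  have c1 : (2 * 3 : R) `^ gamma <= (2 * 4) `^ gamma * (1 + gamma * ((2 * 3) / (2 * 4) - 1)).
    by apply: powR_concave; rewrite ?g0 ?ltW //; lra.
  have c2 : (3 * 4 : R) `^ gamma <= (2 * 4) `^ gamma * (1 + gamma * ((3 * 4) / (2 * 4) - 1)).
    by apply: powR_concave; rewrite ?g0 ?ltW //; lra.
  rewrite (_ : 2 * 3 / (2 * 4) = 3 / 4) in c1; last by field.
  rewrite (_ : 3 * 4 / (2 * 4) = 3 / 2) in c2; last by field.
  have a1 : 1 < (2 : R) `^ gamma.
    by have := @powR_lt R 1 2 gamma g0; rewrite powR1; apply; lra.
  have q0 : (0 : R) < (2 * 3) `^ gamma by apply: powR_gt0; lra.
  have c3 : 2 * (2 * 3 : R) `^ gamma + (3 * 4) `^ gamma <= 3 * (2 * 4) `^ gamma by lra.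
  have e1 : (3 * 4 : R) `^ gamma = 2 `^ gamma * (2 * 3) `^ gamma.
    by rewrite -powRM ?mulr_ge0 //; congr (_ `^ _); lra.
  have e2 : (4 * 4 : R) `^ gamma = 2 `^ gamma * (2 * 4) `^ gamma.
    by rewrite -powRM ?mulr_ge0 //; congr (_ `^ _); lra.
  rewrite e1 in c3 *; rewrite e2.
  move: (2 `^ gamma) ((2 * 3) `^ gamma) ((2 * 4) `^ gamma) a1 q0 c3 => a q p a1 q0 c3.
  (* With [p >= (a + 2) q / 3] this is [(a - 1) ^+ 2 * q > 0]. *)
  have pos : 0 < (a - 1) ^+ 2 * q by rewrite mulr_gt0 // exprn_gt0 // subr_gt0.
  have : (a + 2) * (2 * q + a * q) <= (a + 2) * (3 * p) by rewrite ler_pM2l //; lra.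
  nra.
Qed.

Lemma abc_extremal n (B L Z : graph point) : 1 < gamma ->
  (3 <= n)%N -> Omega n B -> linear_chain n L -> zigzag_chain n Z ->
  extremal_bounds (abc gamma) B L Z.
Proof.
move=> g1; have g0 : 0 < gamma by apply: lt_trans g1.
apply: (@extremal_chains R (fun i j => ((i%:R + j%:R - 2) / (i%:R * j%:R)) `^ gamma)
  (fun G e => ((\sum_(v <- e) (degree G v)%:R - 2)
               / \prod_(v <- e) (degree G v)%:R) `^ gamma)).
- by move=> i j; rewrite mulrC [j%:R + _]addrC [j%:R * _]mulrC mulrC.
- by move=> G u v uv; rewrite !big_fset2.
- move=> G H f e GL HL fI fV fE eG; congr (((_ - _) / _) `^ _).
    exact: (isomorphic_big GL HL fI fV fE +%R (fun d => d%:R)).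
  exact: (isomorphic_big GL HL fI fV fE *%R (fun d => d%:R)).
- by apply: powR_amgm2 => //; lra.
(* Strict convexity, as [3 * (4 / 9) = 2 * (5 / 12) + 1 / 2]. *)
- rewrite (_ : (3 + 3 - 2) / (3 * 3) = 4 / 9); last by field.
  rewrite (_ : (3 + 4 - 2) / (3 * 4) = 5 / 12); last by field.
  rewrite (_ : (2 + 3 - 2) / (2 * 3) = 1 / 2); last by field.
  have c1 : (4 / 9 : R) `^ gamma * (1 + gamma * (5 / 12 / (4 / 9) - 1)) < (5 / 12) `^ gamma.
    by apply: powR_strict_convex; rewrite ?lt_eqF //; lra.
  have c2 : (4 / 9 : R) `^ gamma * (1 + gamma * (1 / 2 / (4 / 9) - 1)) < (1 / 2) `^ gamma.
    by apply: powR_strict_convex; rewrite ?gt_eqF //; lra.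
  rewrite (_ : 5 / 12 / (4 / 9) = 15 / 16) in c1; last by field.
  rewrite (_ : 1 / 2 / (4 / 9) = 9 / 8) in c2; last by field.
  lra.
- have : 2 * ((3 + 4 - 2) / (3 * 4) : R) `^ gamma
      < ((4 + 4 - 2) / (4 * 4)) `^ gamma + ((2 + 4 - 2) / (2 * 4)) `^ gamma.
    by apply: powR_amgm2 => //; lra.
  rewrite (_ : (2 + 3 - 2) / (2 * 3) = (2 + 4 - 2) / (2 * 4) :> R); last by field.
  lra.
Qed.

Lemma sum_conn_extremal n (B L Z : graph point) : 0 < gamma ->
  (3 <= n)%N -> Omega n B -> linear_chain n L -> zigzag_chain n Z ->
  extremal_bounds (sum_conn gamma) B L Z.
Proof.
move=> g0; apply: (@extremal_chains R (fun i j => (i%:R + j%:R) `^ gamma)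
  (fun G e => (\sum_(v <- e) (degree G v)%:R) `^ gamma)).
- by move=> i j; rewrite addrC.
- by move=> G u v uv; rewrite big_fset2.
- move=> G H f e GL HL fI fV fE eG; congr (_ `^ _).
  exact: (isomorphic_big GL HL fI fV fE +%R (fun d => d%:R)).
- rewrite (addrC 2 4) (_ : 4 + 2 = 3 + 3 :> R); last by ring.
  by rewrite mulr_natl mulr2n ltrD2r; apply: powR_lt => //; lra.
- by apply: powR_amgm3 => //; lra.
(* With [h x := x `^ gamma] the claim is [2 h 7 + h 5 < h 8 + 2 h 6].  For
   [gamma >= 1] the midpoint of [8] and [6] gives [2 h 7 <= h 8 + h 6]; for
   [gamma < 1] the midpoint of [7] and [5] gives [h 7 + h 5 <= 2 h 6]. *)
- rewrite (_ : 2 + 4 = 3 + 3 :> R); last by ring.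
  have c0 : (2 + 3 : R) `^ gamma < (3 + 3) `^ gamma by apply: powR_lt => //; lra.
  have c1 : (3 + 4 : R) `^ gamma < (4 + 4) `^ gamma by apply: powR_lt => //; lra.
  have [g1|g1] := leP 1 gamma.
    have p0 : (0 : R) < (3 + 4) `^ gamma by apply: powR_gt0; lra.
    have c2 : (3 + 4 : R) `^ gamma * (1 + gamma * ((4 + 4) / (3 + 4) - 1)) <= (4 + 4) `^ gamma.
      by apply: powR_convex => //; lra.
    have c3 : (3 + 4 : R) `^ gamma * (1 + gamma * ((3 + 3) / (3 + 4) - 1)) <= (3 + 3) `^ gamma.
      by apply: powR_convex => //; lra.
    rewrite (_ : (4 + 4) / (3 + 4) = 8 / 7) in c2; last by field.
    rewrite (_ : (3 + 3) / (3 + 4) = 6 / 7) in c3; last by field.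
    lra.
  have c2 : (2 + 3 : R) `^ gamma <= (3 + 3) `^ gamma * (1 + gamma * ((2 + 3) / (3 + 3) - 1)).
    by apply: powR_concave; rewrite ?g0 ?ltW //; lra.
  have c3 : (3 + 4 : R) `^ gamma <= (3 + 3) `^ gamma * (1 + gamma * ((3 + 4) / (3 + 3) - 1)).
    by apply: powR_concave; rewrite ?g0 ?ltW //; lra.
  rewrite (_ : (2 + 3) / (3 + 3) = 5 / 6) in c2; last by field.
  rewrite (_ : (3 + 4) / (3 + 3) = 7 / 6) in c3; last by field.
  lra.
Qed.

End Indices.

Theorem corollary2p16 (R : realType) (gamma : R) (n : nat)
    (B L Z : graph point) :
  (3 <= n)%N -> Omega n B -> linear_chain n L -> zigzag_chain n Z ->
  [/\ 0 < gamma -> extremal_bounds (randic gamma) B L Z,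
      1 < gamma -> extremal_bounds (abc gamma) B L Z
    & 0 < gamma -> extremal_bounds (sum_conn gamma) B L Z].
Proof.
move=> n3 OB Ll Zz; split=> g.
- exact: randic_extremal n3 OB Ll Zz.
- exact: abc_extremal n3 OB Ll Zz.
- exact: sum_conn_extremal n3 OB Ll Zz.
Qed.
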